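(* Consider the Edwards–Anderson model on the half-plane $G=\mathbb{Z}\times\mathbb{N}$ with i.i.d. couplings $J=(J_{xy})_{\{x,y\}\in E}$ of law $\nu$, where each $J_{xy}$ has a continuous distribution with support equal to $\mathbb{R}$. Let $\mathcal{G}(J)$ be the set of infinite-volume ground states at couplings $J$. Then either $|\mathcal{G}(J)|=2$ with $\nu$-probability one, or $|\mathcal{G}(J)|=\infty$ with $\nu$-probability one.
   Context: The half-plane $\mathbb{Z}\times\mathbb{N}$ ($\mathbb{N}=\{0,1,2,\dots\}$) is the graph with vertex set $V=\mathbb{Z}\times\mathbb{N}$ and edge set $E$ consisting of the nearest-neighbour pairs (the subgraph of $\mathbb{Z}^2$ induced on the half-plane). The couplings form a random element $J\in\mathbb{R}^E$ with i.i.d. coordinates; $\nu$ denotes the product law. ''Continuous distribution'' means without atoms. For finite $A\subset V$, $\partial A\subset E$ is the set of edges $\{x,y\}$ with $x\in A$, $y\notin A$. The set of ground states at couplings $J$ is $$\mathcal{G}(J)=\Big\{\sigma\in\{-1,+1\}^V:\ \forall A\subset V\text{ finite},\ \sum_{\{x,y\}\in\partial A}J_{xy}\sigma_x\sigma_y\ge 0\Big\}.$$ *)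

(* Defs.v *)
From mathcomp Require Import all_boot all_order all_algebra.
From mathcomp Require Import finmap zify.
From mathcomp Require Import all_classical all_reals all_analysis.

Set Implicit Arguments.
Unset Strict Implicit.
Unset Printing Implicit Defensive.

Import Order.TTheory GRing.Theory Num.Theory.
Import numFieldNormedType.Exports.

Local Open Scope classical_set_scope.
Local Open Scope ring_scope.

Definition vertex : Type := (int * nat)%type.

Definition adjacent (x y : vertex) : bool :=
  (`|x.1 - y.1| + `|x.2%:Z - y.2%:Z| == 1 :> int).

Definition edge : Type :=
  {e : {fset vertex} |
    `[< exists x y : vertex, adjacent x y /\ e = [fset x; y]%fset >]}.

Definition boundary (A : {fset vertex}) : set edge :=
  [set e | exists x y : vertex,
     [/\ val e = [fset x; y]%fset, x \in A & y \notin A]].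

Lemma adjacent_neq (x y : vertex) : adjacent x y -> x != y.
Proof. by apply: contraTneq => ->; rewrite /adjacent !subrr. Qed.

Lemma prod_edge (R : realType) (sigma : vertex -> R) (e : edge) (x y : vertex) :
  val e = [fset x; y]%fset -> \prod_(z <- val e) sigma z = sigma x * sigma y.
Proof.
case: e => e /= /asboolP [u [v [uv ->]]] exy.
have cuv : #|` [fset u; v]%fset| = 2%N by rewrite cardfs2 adjacent_neq.
have xy : x != y by apply/eqP => xy; move: cuv; rewrite exy xy cardfs2 eqxx.
rewrite exy big_fsetU1 /= ?big_seq_fset1 //.
by rewrite inE.
Qed.

(* [\sum_(e \in boundary A) _] is an unrestricted sum only when the
   boundary is finite (it is 0 by convention on infinite supports). *)
Lemma finite_boundary (A : {fset vertex}) : finite_set (boundary A).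
Proof.
pose nbr (x : vertex) : seq vertex :=
  [:: (x.1 + 1, x.2); (x.1 - 1, x.2); (x.1, x.2.+1); (x.1, x.2.-1)].
pose s : seq {fset vertex} := [seq [fset x; y]%fset | x <- A, y <- nbr x].
apply: (@sub_finite_set _ _ (val @^-1` [set` s])); last first.
  apply: finite_preimage; last exact: finite_seq.
  by move=> u v _ _; exact: val_inj.
move=> e [x [y [exy xA yA]]] /=; rewrite exy.
apply/allpairsPdep; exists x, y; split => //.
have [u [v [uv euv]]] : exists u v, adjacent u v /\ val e = [fset u; v]%fset.
  by case: e {exy} => e /= /asboolP.
have xy : adjacent x y.
  have nxy : x != y by apply: contraNneq yA => <-.
  have := fset21 x y; have := fset22 x y; rewrite -exy euv !inE.
  have vu : adjacent v u.
    by move: uv; rewrite /adjacent distrC (distrC u.2%:Z).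
  by move=> /orP[] /eqP yE /orP[] /eqP xE; move: nxy; rewrite xE yE // eqxx.
move: xy; rewrite /adjacent; case: x y {xA yA exy} => [a b] [c d] /= h.
rewrite !inE !xpair_eqE /=; lia.
Qed.

Section HalfPlane.
Variable R : realType.

Definition ground_states (J : edge -> R) : set (vertex -> R) :=
  [set sigma | (forall x, sigma x = -1 \/ sigma x = 1) /\
    forall A : {fset vertex},
      0 <= \sum_(e \in boundary A) J e * \prod_(z <- val e) sigma z].

(* The product (cylinder) sigma-algebra on R^E. *)
Definition cylinders : set (set (edge -> R)) :=
  [set C | exists e : edge, exists B : set (measurableTypeR R),
     measurable B /\ C = (fun J => J e) @^-1` B].

Definition couplings := g_sigma_algebraType cylinders.

(* The coordinates are i.i.d. with law mu under nu, i.e. nu is the product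
   measure mu^E. *)
Definition product_law (mu : probability (measurableTypeR R) R)
    (nu : probability couplings R) : Prop :=
  forall (F : {fset edge}) (B : edge -> set (measurableTypeR R)),
    (forall e, measurable (B e)) ->
    nu [set J : couplings | forall e, e \in F -> B e (J e)] =
      (\prod_(e <- F) mu (B e))%E.

Definition atomless (mu : probability (measurableTypeR R) R) : Prop :=
  forall x : R, mu [set x] = 0%E.

Definition law_support (mu : probability (measurableTypeR R) R) : set R :=
  [set x | forall U : set R, open U -> U x -> (0 < mu U)%E].

End HalfPlane.

(* Main.v *)
From Pilot Require Import Defs.
From mathcomp Require Import all_boot all_order all_algebra.
From mathcomp Require Import finmap zify lra.
From mathcomp Require Import all_classical all_reals all_analysis.
From mathcomp Require Import measurable_realfun.
(* all_analysis exports other constants named [adjacent] and so on. *)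
Import Pilot.Defs.

(* Suppose that the set [gs J] of ground states, encoded by [vertex -> bool], is
   finite almost surely, and identify configurations that differ by a global
   flip. Two facts then hold almost surely.

   (1) Different ground states disagree, and agree, arbitrarily far to the right
   on the bottom row. A last site of disagreement would be a stationary finite
   random set, which is impossible. If two ground states agree on the whole
   bottom row, they must have the same flexibility (minimal energy of a finite
   flip crossing the edge) at every bottom edge: otherwise lower the coupling
   until only one of them is lost; a limit of finite-volume minimizers with the
   boundary values of the lost state differs from the surviving one on an
   interval of the bottom row, by planarity, contradicting the first assertion. But
   the flexibilities can be made different by raising couplings where the states
   agree and slightly shifting some where they disagree, both of which keep the
   two states ground states.

   (2) In a large box change the boundary condition from one ground state to
   another, one site at a time. Successive minimizers differ on a connected set
   without holes, whose trace on the bottom row is an interval by planarity. Near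
   the origin each minimizer coincides with one of the finitely many ground
   states, so by (1) the ground state seen near the origin never changes: there
   is only one.

   Finiteness of [gs J] is a translation invariant event, of probability 0 or 1
   because the product law is mixing. *)

Set Implicit Arguments.
Unset Strict Implicit.
Unset Printing Implicit Defensive.

Import Order.TTheory GRing.Theory Num.Theory.
Import numFieldNormedType.Exports.

Local Open Scope classical_set_scope.
Local Open Scope ring_scope.
Local Open Scope card_scope.

(** * Edges, cuts and energies *)

Lemma adjacentC (x y : vertex) : adjacent x y = adjacent y x.
Proof. by rewrite /adjacent distrC (distrC x.2%:Z). Qed.

Lemma edge_ends (e : edge) :
  exists p : vertex * vertex, adjacent p.1 p.2 /\ val e = [fset p.1; p.2]%fset.
Proof.
by case: e => e /= /asboolP [x [y [xy ->]]]; exists (x, y).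
Qed.

(** The orientation of an edge is an arbitrary choice; by [fset2_ends], nothing symmetric in the two
    ends depends on it. *)
Definition src (e : edge) : vertex := (projT1 (cid (edge_ends e))).1.
Definition dst (e : edge) : vertex := (projT1 (cid (edge_ends e))).2.

Lemma adjacent_ends (e : edge) : adjacent (src e) (dst e).
Proof. by rewrite /src /dst; case: cid => p []. Qed.

Lemma val_edge (e : edge) : val e = [fset src e; dst e]%fset.
Proof. by rewrite /src /dst; case: cid => p []. Qed.

Lemma mk_edge_subproof (x y : vertex) (xy : adjacent x y) :
  `[< exists x' y' : vertex, adjacent x' y' /\
      [fset x; y]%fset = [fset x'; y']%fset >].
Proof. by apply/asboolP; exists x, y. Qed.

Definition mk_edge (x y : vertex) (xy : adjacent x y) : edge :=
  exist _ [fset x; y]%fset (mk_edge_subproof xy).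

(** For the indicator of a finite set this marks the boundary edges; for a configuration [s], the
    product of the spins at the ends of [e] is [(-1) ^+ cut s e]. *)
Definition cut (P : vertex -> bool) (e : edge) : bool := P (src e) (+) P (dst e).

Definition ind (A : {fset vertex}) : vertex -> bool := fun x => x \in A.

Lemma fset2_ends (e : edge) (x y : vertex) : val e = [fset x; y]%fset ->
  (src e = x /\ dst e = y) \/ (src e = y /\ dst e = x).
Proof.
rewrite val_edge => exy.
have sd := adjacent_neq (adjacent_ends e).
have := fset21 (src e) (dst e); have := fset22 (src e) (dst e).
rewrite exy !inE => /orP[] /eqP dE /orP[] /eqP sE; rewrite sE dE in sd *; auto;
  by rewrite eqxx in sd.
Qed.

Lemma cut_fset2 (P : vertex -> bool) (e : edge) (x y : vertex) :
  val e = [fset x; y]%fset -> cut P e = P x (+) P y.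
Proof. by rewrite /cut => /fset2_ends[] [-> ->]//; rewrite addbC. Qed.

Lemma cut_mk (P : vertex -> bool) (x y : vertex) (xy : adjacent x y) :
  cut P (mk_edge xy) = P x (+) P y.
Proof. exact: cut_fset2. Qed.

Lemma cut_addb (P Q : vertex -> bool) (e : edge) :
  cut (fun x => P x (+) Q x) e = cut P e (+) cut Q e.
Proof. by rewrite /cut addbACA. Qed.

Lemma boundaryE (A : {fset vertex}) (e : edge) : boundary A e <-> cut (ind A) e.
Proof.
split=> [[x [y [exy xA yA]]]|].
  by rewrite (cut_fset2 _ exy) /ind xA (negbTE yA).
rewrite /cut /ind; case: (boolP (src e \in A)) => sA /= dA.
  by exists (src e), (dst e); split => //; exact: val_edge.
by exists (dst e), (src e); split => //; rewrite val_edge fsetUC.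
Qed.

Definition bnd (A : {fset vertex}) : {fset edge} := fset_set (boundary A).

Lemma in_bnd (A : {fset vertex}) (e : edge) : (e \in bnd A) = cut (ind A) e.
Proof.
rewrite /bnd in_fset_set; last exact: finite_boundary.
by apply/idP/idP; rewrite inE boundaryE.
Qed.

Definition flip (s : vertex -> bool) (A : {fset vertex}) : vertex -> bool :=
  fun x => s x (+) (x \in A).

Definition symd (A B : {fset vertex}) : {fset vertex} :=
  ((A `\` B) `|` (B `\` A))%fset.

Lemma in_symd (A B : {fset vertex}) x : (x \in symd A B) = (x \in A) (+) (x \in B).
Proof. by rewrite !inE; case: (x \in A); case: (x \in B). Qed.

Lemma cut_flip s A e : cut (flip s A) e = cut s e (+) cut (ind A) e.
Proof. exact: cut_addb. Qed.

Lemma cut_symd A B e : cut (ind (symd A B)) e = cut (ind A) e (+) cut (ind B) e.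
Proof. by rewrite -cut_addb /cut /ind !in_symd. Qed.

Lemma flip_out s A x : x \notin A -> flip s A x = s x.
Proof. by rewrite /flip => /negbTE ->; rewrite addbF. Qed.

Section Energy.
Variable R : realType.
Implicit Types (J : edge -> R) (s : vertex -> bool) (A B : {fset vertex}).

(** Half the increase in energy caused by flipping [A] in [s]. *)
Definition en J s A : R := \sum_(e <- bnd A) J e * (-1) ^+ cut s e.

Lemma en_widen J s A (F : {fset edge}) : (bnd A `<=` F)%fset ->
  en J s A = \sum_(e <- F) (cut (ind A) e)%:R * (J e * (-1) ^+ cut s e).
Proof.
move=> AF; rewrite -(big_fset_incl _ AF) /=; last first.
  by move=> e _; rewrite in_bnd => /negbTE ->; rewrite mul0r.
by apply: eq_big_seq => e; rewrite in_bnd => ->; rewrite mul1r.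
Qed.

(** Flipping [A] and then [B] amounts to flipping [symd A B], so the costs add up. *)
Lemma en_flip J s A B : en J (flip s A) B = en J s (symd A B) - en J s A.
Proof.
pose F := (bnd A `|` bnd B)%fset.
have FA : (bnd A `<=` F)%fset by exact: fsubsetUl.
have FB : (bnd B `<=` F)%fset by exact: fsubsetUr.
have FAB : (bnd (symd A B) `<=` F)%fset.
  apply/fsubsetP => e; rewrite in_fsetU !in_bnd cut_symd.
  by case: (cut _ e).
rewrite (en_widen _ _ FA) (en_widen _ _ FB) (en_widen _ _ FAB) -sumrB.
apply: eq_bigr => e _; rewrite cut_flip cut_symd signr_addb.
rewrite (mulrA (J e)); move: (J e * (-1) ^+ cut s e) => x.
by case: (cut (ind A) e); case: (cut (ind B) e);
  rewrite /= ?expr0 ?expr1 ?mulr1n ?mulr0n ?mulrN ?mulr1 ?mul1r ?mul0r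
    ?subr0 ?sub0r ?subrr ?oppr0.
Qed.

Lemma en_opp J s s' A : (forall e, cut (ind A) e -> cut s' e = ~~ cut s e) ->
  en J s' A = - en J s A.
Proof.
move=> H; rewrite /en -sumrN; apply: eq_big_seq => e; rewrite in_bnd => /H ->.
by rewrite signrN mulrN.
Qed.

Lemma eq_en J J' s s' A :
  (forall e, cut (ind A) e -> J e = J' e) ->
  (forall e, cut (ind A) e -> cut s e = cut s' e) -> en J s A = en J' s' A.
Proof.
by move=> HJ Hs; apply: eq_big_seq => e; rewrite in_bnd => He; rewrite HJ// Hs.
Qed.

Definition upd J e t : edge -> R := fun f => if f == e then t else J f.

Lemma en_upd J e t s A : en (upd J e t) s A =
  en J s A + (cut (ind A) e)%:R * ((t - J e) * (-1) ^+ cut s e).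
Proof.
case: (boolP (cut (ind A) e)) => eA; last first.
  rewrite mul0r addr0; apply: eq_en => // f fA; rewrite /upd; case: eqP => // fe.
  by rewrite fe (negbTE eA) in fA.
have eB : e \in bnd A by rewrite in_bnd.
rewrite mul1r /en !(big_fsetD1 _ eB) /= {1}/upd eqxx.
rewrite (eq_big_seq (fun f => J f * (-1) ^+ cut s f)); first by
  move: ((-1) ^+ _) (\sum_(_ <- _) _) => c X; lra.
by move=> f; rewrite !inE /upd => /andP[/negbTE ->].
Qed.

Definition gs J : set (vertex -> bool) := [set s | forall A, 0 <= en J s A].

Definition spin s : vertex -> R := fun x => (-1) ^+ s x.

Lemma spin_inj : injective spin.
Proof.
move=> s s' ss'; apply/funext => x; apply: (@signr_inj R).
exact: (congr1 (fun f => f x) ss').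
Qed.

Lemma ground_statesE J : ground_states J = spin @` gs J.
Proof.
have enE s A : \sum_(e \in boundary A) J e * \prod_(z <- val e) spin s z = en J s A.
  rewrite (fsbig_finite _ _ (finite_boundary A)).
  apply: eq_bigr => e _; rewrite (prod_edge _ (val_edge e)).
  by rewrite /spin -signr_addb.
apply/seteqP; split => [sigma [s1 sA]|_ [s sG <-]]; last first.
  split=> [x|A]; last by rewrite enE.
  by rewrite /spin; case: (s x); [left|right].
have ss : sigma = spin (fun x => sigma x == -1).
  apply/funext => x; rewrite /spin; case: eqP => [->//|].
  by case: (s1 x) => ->.
exists (fun x => sigma x == -1) => //= A.
by rewrite -enE -ss.
Qed.

End Energy.

(** * Planarity of the half-plane *)

Section Planarity.
Implicit Types (x a b c : int) (y : nat) (u w : vertex) (p : seq vertex).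

(** The step from [u] to [w] crosses the vertical half-line going up from the point (x + 1/2, y -
    1/2); [winding] is the parity of such crossings along a path. *)
Definition crossing x y u w : bool :=
  [&& u.2 == w.2, (y <= u.2)%N &
      ((u.1 == x) && (w.1 == x + 1)) || ((u.1 == x + 1) && (w.1 == x))].

Fixpoint winding x y u p : bool :=
  if p is w :: p' then crossing x y u w (+) winding x y w p' else false.

Lemma adjacentP u w : adjacent u w ->
  [\/ w = (u.1 + 1, u.2), u = (w.1 + 1, w.2), w = (u.1, u.2.+1) |
     u = (w.1, w.2.+1)].
Proof.
case: u => u1 u2; case: w => w1 w2; rewrite /adjacent /= => uw.
have : [\/ w1 = u1 + 1 /\ u2 = w2, u1 = w1 + 1 /\ u2 = w2,
  w1 = u1 /\ w2 = u2.+1 | w1 = u1 /\ u2 = w2.+1].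
  have [e2|n2] := eqVneq u2 w2.
    have [e1|n1] := eqVneq w1 (u1 + 1); first by constructor 1.
    by constructor 2; split => //; lia.
  have e1 : w1 = u1 by lia.
  have [e3|n3] := eqVneq w2 u2.+1; first by constructor 3.
  by constructor 4; split => //; lia.
move=> [] [-> ->]; by [constructor 1|constructor 2|constructor 3|constructor 4].
Qed.

(** The two half-lines differ by one horizontal edge, which ends at the avoided site [(x, y)]. *)
Lemma winding_up x y u p : (x, y) \notin u :: p ->
  winding x y.+1 u p = winding x y u p.
Proof.
elim: p u => //= w p IHp [u1 u2]; rewrite inE negb_or => /andP[nu nwp].
rewrite IHp //; congr addb.
move: nu nwp; rewrite inE negb_or => + /andP[+ _].
case: w => w1 w2; rewrite !xpair_eqE /crossing /=; lia.
Qed.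

(** A crossing at height [j] uses the site [(x, j)]. *)
Lemma winding_col x y u p : (forall j, (y <= j)%N -> (x, j) \notin u :: p) ->
  winding x y u p = false.
Proof.
elim: p u => //= w p IHp [u1 u2] H.
rewrite IHp => [|j /H]; last by rewrite inE negb_or => /andP[].
case: w H {IHp} => w1 w2 H; rewrite addbF /crossing /=.
apply/negbTE/negP => /and3P[/eqP uw yu].
move: (H _ yu); rewrite !inE !xpair_eqE !negb_or uw; lia.
Qed.

Lemma winding_far x y u p : (forall w, w \in u :: p -> w.1 != x) ->
  winding x y u p = false.
Proof.
elim: p u => //= w p IHp u H.
rewrite IHp => [|v vp]; last by apply: H; rewrite inE vp orbT.
have := H u (mem_head _ _); have := H w; rewrite !inE eqxx orbT => /(_ isT).
rewrite /crossing; lia.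
Qed.

(** Crossings of the two half-lines are the steps entering or leaving the half-column of sites
    [(x + 1, j)] with [j > y], because its lower neighbour [(x + 1, y)] is avoided. Their parity is
    read off the ends of the path. *)
Lemma winding_right x y u p : path adjacent u p ->
  (x, y) \notin u :: p -> (x + 1, y) \notin u :: p ->
  winding x y u p (+) winding (x + 1) y u p =
  ((u.1 == x + 1) && (y < u.2)%N) (+)
  (((last u p).1 == x + 1) && (y < (last u p).2)%N).
Proof.
elim: p u => /= [u _ _ _|w p IHp u /andP[uw wp]]; first by rewrite addbb.
rewrite inE negb_or => /andP[xu xp]; rewrite inE negb_or => /andP[xu' xp'].
rewrite addbACA IHp // addbA; congr addb.
move: xp xp'; rewrite !inE !negb_or => /andP[xw _] /andP[xw' _].
move: xu xu' xw xw' (adjacentP uw); case: u {uw} => u1 u2; case: w {IHp wp} => w1 w2.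
rewrite /crossing !xpair_eqE /= => n1 n2 n3 n4 [] [? ?]; subst; rewrite ?eqxx /=.
- have -> : (u1 == x) && (u1 + 1 == x + 1) || (u1 == x + 1) && (u1 + 1 == x) =
    (u1 == x) by lia.
  have -> : (u1 == x + 1) && (u1 + 1 == x + 1 + 1) ||
    (u1 == x + 1 + 1) && (u1 + 1 == x + 1) = (u1 == x + 1) by lia.
  have -> : (u1 + 1 == x + 1) = (u1 == x) by lia.
  move: n1 n2; rewrite ![_ == u1]eq_sym.
  by case: (u1 == x); case: (u1 == x + 1); case: ltngtP.
- have -> : (w1 + 1 == x) && (w1 == x + 1) || (w1 + 1 == x + 1) && (w1 == x) =
    (w1 == x) by lia.
  have -> : (w1 + 1 == x + 1) && (w1 == x + 1 + 1) ||
    (w1 + 1 == x + 1 + 1) && (w1 == x + 1) = (w1 == x + 1) by lia.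
  have -> : (w1 + 1 == x + 1) = (w1 == x) by lia.
  move: n3 n4; rewrite ![_ == w1]eq_sym.
  by case: (w1 == x); case: (w1 == x + 1); case: ltngtP.
- have -> : (u2 == u2.+1) = false by lia.
  move: n2; rewrite eq_sym /=; case: (u1 == x + 1) => //= n2; lia.
- have -> : (w2.+1 == w2) = false by lia.
  move: n4; rewrite eq_sym /=; case: (w1 == x + 1) => //= n4; lia.
Qed.

(** From height 0 the half-line separates the half-plane, so only the sides of the two ends
    matter. *)
Lemma winding_bottom b u p : path adjacent u p ->
  winding b 0 u p = (u.1 <= b) (+) ((last u p).1 <= b).
Proof.
elim: p u => /= [u _|w p IHp u /andP[uw wp]]; first by rewrite addbb.
rewrite IHp // addbA; congr addb.
move: uw; case: u => u1 u2; case: w {IHp wp} => w1 w2.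
rewrite /crossing /adjacent /=; lia.
Qed.

End Planarity.

Section Enclosure.
Implicit Types (x a b c : int) (y : nat) (A : {fset vertex}).

Lemma first_coord_bound (s : seq vertex) : exists m : nat,
  forall w, w \in s -> `|w.1| < m%:Z.
Proof.
elim: s => [|w s [m IH]]; first by exists 0%N.
exists (m + `|w.1|%N).+1 => v; rewrite inE => /orP[/eqP ->|/IH];
  by case: w v => w1 w2 [v1 v2] /=; lia.
Qed.

(** With both ends on the bottom row, the end terms of [winding_right] vanish: [winding] is constant
    along a horizontal ray that avoids the path, and it is zero far away. *)
Lemma winding_half_row x y u p (d : int) : d = 1 \/ d = -1 ->
  path adjacent u p -> u.2 = 0%N -> (last u p).2 = 0%N ->
  (forall n : nat, (x + n%:Z * d, y) \notin u :: p) -> winding x y u p = false.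
Proof.
move=> d1 up u0 l0 ray.
have step n : winding (x + n%:Z * d) y u p = winding x y u p.
  elim: n => [|n <-]; first by rewrite mul0r addr0.
  have rn := ray n; have rn1 := ray n.+1.
  case: d1 ray rn rn1 => -> ray rn rn1.
    have xE : x + n.+1%:Z * 1 = x + n%:Z * 1 + 1 by lia.
    rewrite xE in rn1 *.
    have := winding_right up rn rn1; rewrite u0 l0 !ltn0 !andbF.
    by case: (winding _ _ _ _); case: (winding _ _ _ _).
  have xE : x + n%:Z * -1 = x + n.+1%:Z * -1 + 1 by lia.
  rewrite xE in rn *.
  have := winding_right up rn1 rn; rewrite u0 l0 !ltn0 !andbF.
  by case: (winding _ _ _ _); case: (winding _ _ _ _).
have [m mP] := first_coord_bound (u :: p).
rewrite -(step (m + `|x|)%N); apply: winding_far => -[w1 w2] /mP /=.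
by case: d1 {step ray} => ->; lia.
Qed.

(* The sites outside [A] around which a path from [(a, 0)] to [(c, 0)] inside
   [A] winds (an odd number of times) form [K]. *)
Lemma enclosed A a b c p : a < b -> b < c -> path adjacent (a, 0%N) p ->
  last (a, 0%N) p = (c, 0%N) -> {subset (a, 0%N) :: p <= A} ->
  (b, 0%N) \notin A ->
  exists K : {fset vertex}, [/\ (b, 0%N) \in K,
    forall e, cut (ind K) e -> cut (ind A) e &
    forall x y, (x, y) \in K ->
      [/\ (x, y) \notin A, exists2 j, (y <= j)%N & (x, j) \in A &
        forall d : int, d = 1 \/ d = -1 -> exists n : nat, (x + n%:Z * d, y) \in A]].
Proof.
move=> ab bc path_p last_p pA bA.
have notin v : v \notin A -> v \notin (a, 0%N) :: p.
  by apply: contra => /pA.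
pose W v := winding v.1 v.2 (a, 0%N) p.
have W_col x y : W (x, y) -> exists2 j, (y <= j)%N & (x, j) \in A.
  move=> Wxy; apply: contrapT => H.
  rewrite /W winding_col in Wxy => // j yj; apply/notin/negP => xjA.
  by apply: H; exists j.
have W_row x y d : W (x, y) -> d = 1 \/ d = -1 ->
    exists n : nat, (x + n%:Z * d, y) \in A.
  move=> Wxy d1; apply: contrapT => H.
  have : W (x, y) = false.
    apply: (winding_half_row d1) => //; first by rewrite last_p.
    by move=> n; apply/notin/negP => xnA; apply: H; exists n.
  by rewrite Wxy.
(* The sites with odd winding form a finite set: such a site has a site of [A] in its column and
   another in its row. *)
pose K := [fset u in [fset (w.1, v.2) | w in A, v in A] |
             (u \notin A) && W u]%fset.
have inK u : (u \in K) = (u \notin A) && W u.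
  rewrite !inE /= andb_idl // => /andP[_]; case: u => x y Wxy.
  have [j _ xjA] := W_col _ _ Wxy.
  have [n xnA] := W_row _ _ 1 Wxy (or_introl erefl).
  by apply/imfset2P; exists (x, j) => //=; exists (x + n%:Z * 1, y).
(* Outside [A] the parity does not change along an edge, so every edge cutting [K] has an end in
   [A]. *)
have W_adj u v : u \notin A -> v \notin A -> adjacent u v -> W u = W v.
  move=> /notin uA /notin vA uv.
  wlog : u v uA vA uv / u.2 = v.2 /\ v.1 = u.1 + 1 \/ u.1 = v.1 /\ v.2 = u.2.+1.
    move=> H; have [|] := boolP ((u.1 <= v.1) && (u.2 <= v.2)%N) => uv'.
      apply: H => //; move: uv uv'; rewrite /adjacent.
      by case: (u) => ??; case: (v) => ??/=; lia.
    apply/esym/H => //; first by rewrite adjacentC.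
    by move: uv uv'; rewrite /adjacent; case: (u) => ??; case: (v) => ??/=; lia.
  move=> [[uv2 uv1]|[uv1 uv2]]; rewrite /W.
    case: u v uA vA uv2 uv1 {uv} => x y [v1 v2] uA vA /= yE vE; rewrite vE -yE in vA *.
    have := winding_right path_p uA vA; rewrite last_p !ltn0 !andbF.
    by case: (winding _ _ _ _); case: (winding _ _ _ _).
  case: u v uA vA uv2 uv1 {uv} => x y [v1 v2] uA vA /= yE xE; rewrite yE -xE in vA *.
  by rewrite winding_up.
exists K; split.
- by rewrite inK bA /W winding_bottom //= last_p /=; lia.
- move=> e; rewrite /cut /ind !inK.
  case: (boolP (src e \in A)) => sA; case: (boolP (dst e \in A)) => dA //=.
  by rewrite (W_adj _ _ sA dA (adjacent_ends e)) addbb.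
- move=> x y; rewrite inK => /andP[xyA Wxy]; split => //; first exact: W_col.
  by move=> d; exact: W_row.
Qed.

(** An edge leaving the component but not [A] would extend a path from [z], so the boundary of the
    component is part of that of [A]. *)
Lemma component A (z : vertex) : z \in A -> exists C : {fset vertex},
  [/\ z \in C, {subset C <= A}, forall e, cut (ind C) e -> cut (ind A) e &
   forall w, w \in C -> exists p, [/\ path adjacent z p, last z p = w &
     {subset z :: p <= A}]].
Proof.
move=> zA.
pose conn w := exists p, [/\ path adjacent z p, last z p = w & {subset z :: p <= A}].
pose C := [fset w in A | `[< conn w >]]%fset.
have inC w : (w \in C) = (w \in A) && `[< conn w >] by rewrite !inE.
have ext u v : adjacent u v -> u \in C -> v \in A -> v \in C.
  move=> uv; rewrite !inC => /andP[uA /asboolP [p [zp pu pA]]] vA.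
  rewrite vA; apply/asboolP; exists (rcons p v); split.
  - by rewrite rcons_path zp pu.
  - by rewrite last_rcons.
  - move=> x; rewrite -rcons_cons mem_rcons inE => /orP[/eqP ->//|]; exact: pA.
exists C; split.
- rewrite inC zA; apply/asboolP; exists [::]; split => // x.
  by rewrite inE => /eqP ->.
- by move=> w; rewrite inC => /andP[].
- move=> e; rewrite /cut /ind => H.
  have CA w : w \in C -> w \in A by rewrite inC => /andP[].
  have se := ext _ _ (adjacent_ends e).
  have de : adjacent (dst e) (src e) by rewrite adjacentC adjacent_ends.
  move: de => /ext de.
  have := CA (src e); have := CA (dst e); move: H se de.
  case: (src e \in C); case: (dst e \in C) => //= _.
    by move=> /(_ isT) H _ _ /(_ isT) ->; case: (dst e \in A) H => // /(_ isT).
  by move=> _ /(_ isT) H /(_ isT) -> _; case: (src e \in A) H => // /(_ isT).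
- by move=> w; rewrite inC => /andP[_ /asboolP].
Qed.

(* [C] is the component of [(a, 0)]; [K] is a hole of [A] around [(b, 0)]. *)
Lemma bottom_trace A a b c : a < b -> b < c -> (a, 0%N) \in A ->
  (c, 0%N) \in A -> (b, 0%N) \notin A ->
  (exists C : {fset vertex}, [/\ (a, 0%N) \in C, (c, 0%N) \notin C,
    {subset C <= A} & forall e, cut (ind C) e -> cut (ind A) e]) \/
  (exists K : {fset vertex}, [/\ (b, 0%N) \in K,
    forall e, cut (ind K) e -> cut (ind A) e &
    forall x y, (x, y) \in K ->
      [/\ (x, y) \notin A, exists2 j, (y <= j)%N & (x, j) \in A &
        forall d : int, d = 1 \/ d = -1 -> exists n : nat, (x + n%:Z * d, y) \in A]]).
Proof.
move=> ab bc aA cA bA.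
have [C [aC CA Cc Cp]] := component aA.
have [cC|cC] := boolP ((c, 0%N) \in C); last by left; exists C.
right; have [p [pp lp pA]] := Cp _ cC.
exact: enclosed pp lp pA bA.
Qed.

End Enclosure.

(** * Stability in finite boxes *)

Definition box (L : nat) : {fset vertex} :=
  [fset v in [seq (i%:Z - L%:Z, j) : vertex |
     i <- iota 0 L.*2.+1, j <- iota 0 L.+1]]%fset.

Lemma in_box L (v : vertex) : (v \in box L) = (`|v.1| <= L%:Z) && (v.2 <= L)%N.
Proof.
case: v => x y; rewrite in_fset.
apply/idP/idP => [/allpairsPdep[i [j [iL jL [-> ->]]]]|/andP[xL yL]].
  by move: iL jL; rewrite !mem_iota /=; lia.
apply/allpairsPdep; exists (absz (x + L%:Z)), y.
split; move: xL yL; rewrite ?mem_iota /=; try lia.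
by move=> xL yL; congr pair; lia.
Qed.

Lemma box_mono L L' : (L <= L')%N -> {subset box L <= box L'}.
Proof. by move=> LL v; rewrite !in_box; lia. Qed.

Lemma sub_box (s : seq vertex) : exists L, {subset s <= box L}.
Proof.
elim: s => [|v s [L IH]]; first by exists 0%N.
exists (L + `|v.1|%N + v.2)%N => w; rewrite inE => /orP[/eqP ->|/IH];
  by rewrite !in_box; lia.
Qed.

Lemma box_adjacent L (x y : vertex) : adjacent x y -> x \in box L -> y \in box L.+1.
Proof. by rewrite !in_box /adjacent; case: x => ??; case: y => ??/=; lia. Qed.

Lemma cut_box L A e : {subset A <= box L} -> cut (ind A) e ->
  (src e \in box L.+1) && (dst e \in box L.+1).
Proof.
move=> AL; have sd := adjacent_ends e; rewrite /cut /ind.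
have bS := @box_mono L L.+1 (leqnSn _).
case: (boolP (src e \in A)) => [/AL sL _|_ /= /AL dL].
  by rewrite (bS _ sL) (box_adjacent sd sL).
by rewrite (bS _ dL) andbT; apply: (box_adjacent _ dL); rewrite adjacentC.
Qed.

Section Stability.
Variable R : realType.
Implicit Types (J : edge -> R) (s : vertex -> bool) (A : {fset vertex}).

(** Finite-volume ground states in [A], with the boundary condition that [s] itself gives outside
    [A]. *)
Definition stable J (A : {fset vertex}) s :=
  forall B : {fset vertex}, {subset B <= A} -> 0 <= en J s B.

Lemma seq_argmin (T : eqType) (f : T -> R) (l : seq T) (x0 : T) : x0 \in l ->
  exists2 x, x \in l & forall y, y \in l -> f x <= f y.
Proof.
elim: l x0 => // a [|b l] IH x0 _.
  by exists a; rewrite ?mem_head // => y; rewrite inE => /eqP ->.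
have [x xl xmin] := IH b (mem_head _ _).
have [ax|xa] := leP (f a) (f x).
  exists a; rewrite ?mem_head // => y; rewrite inE => /orP[/eqP -> //|/xmin].
  exact: le_trans.
exists x; first by rewrite inE xl orbT.
by move=> y; rewrite inE => /orP[/eqP ->|/xmin//]; exact: ltW.
Qed.

(** Flip a subset of [A] of least cost; by [en_flip], the cost of any further flip is a difference
    with this minimum. *)
Lemma exists_stable J A s : exists S : {fset vertex}, [/\ {subset S <= A},
  stable J A (flip s S) & forall B, {subset B <= A} -> en J s S <= en J s B].
Proof.
have [|S] := @seq_argmin _ (en J s) (fpowerset A) fset0.
  by rewrite fpowersetE fsub0set.
rewrite fpowersetE => /fsubsetP SA Smin.
have min B : {subset B <= A} -> en J s S <= en J s B.
  by move=> /fsubsetP BA; apply: Smin; rewrite fpowersetE.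
exists S; split => // B BA; rewrite en_flip subr_ge0; apply: min => x.
by rewrite !inE => /orP[] /andP[_]; [exact: SA | exact: BA].
Qed.

Lemma eq_en_box J s s' A L : {subset A <= box L} ->
  (forall x, x \in box L.+1 -> s x = s' x) -> en J s A = en J s' A.
Proof.
move=> AL ss; apply: eq_en => // e /(cut_box AL) /andP[eL eL'].
by rewrite /cut !ss.
Qed.

(** Compactness: [s] is the limit of [f] along an ultrafilter containing all the tails of the
    natural numbers. *)
Lemma bool_cluster (T : choiceType) (f : nat -> T -> bool) :
  exists s : T -> bool, forall (l : seq T) (N : nat),
    exists2 k, (N <= k)%N & forall x, x \in l -> f k x = s x.
Proof.
have [U [UU oU]] := ultraFilterLemma eventually_filter.
have PU : ProperFilter U := ultra_proper.
pose s x := `[< U [set k | f k x] >].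
have Us x : U [set k | f k x = s x].
  rewrite /s; case: asboolP => [//|nU].
  have [//|] := in_ultra_setVsetC [set k | f k x] UU.
  by apply: filterS => k /= /negP/negbTE.
exists s => l N.
have Ul : U [set k | forall x, x \in l -> f k x = s x].
  elim: l => [|v l IH]; first by apply: filterS filterT => k _.
  apply: filterS2 IH (Us v) => k /= H kv x.
  by rewrite inE => /orP[/eqP ->//|]; exact: H.
have UN : U [set k | (N <= k)%N] by apply: oU; exact: nbhs_infty_ge.
have [k [kl kN]] := filter_ex (filterI Ul UN).
by exists k.
Qed.

Lemma config_cluster (f : nat -> vertex -> bool) : exists s, forall L N : nat,
  exists2 k, (N <= k)%N & forall x, x \in box L -> f k x = s x.
Proof.
have [s sP] := bool_cluster f; exists s => L N.
by have [k Nk ks] := sP (box L) N; exists k.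
Qed.

Lemma config_cluster2 (f g : nat -> vertex -> bool) : exists s u, forall L N : nat,
  exists2 k, (N <= k)%N & forall x, x \in box L -> f k x = s x /\ g k x = u x.
Proof.
(* Coding both sequences as one makes the same indices serve for both limits. *)
pose h k (p : vertex * bool) := if p.2 then f k p.1 else g k p.1.
have [s sP] := bool_cluster h.
exists (fun x => s (x, true)), (fun x => s (x, false)) => L N.
have [k Nk ks] := sP [seq (x, b) | x <- box L, b <- [:: true; false]] N.
exists k => // x xL; split.
  by apply: (ks (x, true)); apply/allpairsP; exists (x, true).
by apply: (ks (x, false)); apply/allpairsP; exists (x, false).
Qed.

Lemma gs_limit J (f : nat -> vertex -> bool) (s : vertex -> bool) :
  (forall k, stable J (box k) (f k)) ->
  (forall L N : nat, exists2 k, (N <= k)%N & forall x, x \in box L -> f k x = s x) ->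
  gs J s.
Proof.
move=> fst fs A; have [L AL] := sub_box A.
have [k Lk fks] := fs L.+1 L.
rewrite -(eq_en_box J AL fks); apply: fst => x /AL; exact: box_mono.
Qed.

Lemma gs_nonempty J : gs J !=set0.
Proof.
pose f k := flip (fun=> false)
  (projT1 (cid (exists_stable J (box k) (fun=> false)))).
have fst k : stable J (box k) (f k) by rewrite /f; case: cid => S [].
have [s fs] := config_cluster f.
by exists s; exact: gs_limit fst fs.
Qed.

Lemma en_neg J s A : en J (fun x => ~~ s x) A = en J s A.
Proof. by apply: eq_en => // e _; rewrite /cut addbN addNb negbK. Qed.

Lemma gs_neg J s : gs J s -> gs J (fun x => ~~ s x).
Proof. by move=> Js A; rewrite en_neg. Qed.

(** Otherwise there are counterexamples in arbitrarily large boxes; their cluster point is a ground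
    state, which coincides with one of them on [box L]. *)
Lemma box_attract J L : exists2 N, (L <= N)%N & forall s, stable J (box N) s ->
  exists2 g, gs J g & forall x, x \in box L -> s x = g x.
Proof.
apply: contrapT => H.
have {}H N : exists s, stable J (box (L + N)) s /\
    ~ (exists2 g, gs J g & forall x, x \in box L -> s x = g x).
  apply: contrapT => HN; apply: H; exists (L + N)%N; first exact: leq_addr.
  by move=> s sst; apply: contrapT => Hs; apply: HN; exists s.
have [f Hf] := choice H.
have [g fg] := config_cluster f.
have [k _ kg] := fg L 0%N.
have [_] := Hf k; apply; exists g => //.
apply: (@gs_limit _ f) => // j A Aj; have [st _] := Hf j.
by apply: st => x /Aj; apply: box_mono; exact: leq_addl.
Qed.

End Stability.

(** * Ground states for generic couplings *)

(** Flipping [S] reverses every boundary term of [X], so the costs of [X] before and after are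
    opposite, and both are nonnegative. *)
Lemma stable_flip_en_eq0 (R : realType) (J J1 : edge -> R) s (S X L : {fset vertex}) :
  stable J1 L (flip s S) -> {subset X <= L} ->
  (forall f, cut (ind X) f -> cut (ind S) f) ->
  (forall f, cut (ind X) f -> J1 f = J f) -> 0 <= en J s X ->
  en J1 s X = 0.
Proof.
move=> st XL XS JX sX.
have E : en J1 s X = en J s X by exact: eq_en.
have : 0 <= en J1 (flip s S) X by exact: st.
rewrite (@en_opp _ _ s); last by move=> f /XS fS; rewrite cut_flip fS addbT.
by move=> h; apply/eqP; rewrite eq_le E sX andbT -E -oppr_ge0.
Qed.

Lemma ltz_succ (x y : int) : x < y -> y != x + 1 -> x + 1 < y.
Proof. by lia. Qed.

Section Generic.
Variable R : realType.
Implicit Types (J : edge -> R) (s : vertex -> bool) (A : {fset vertex}).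

(* Properties of almost every coupling that make the rest of the argument
   deterministic. *)
Record generic (Omega : set (edge -> R)) : Prop := Generic {
  generic_finite : forall J, Omega J -> finite_set (gs J);
  generic_nomax : forall J, Omega J -> forall s s', gs J s -> gs J s' ->
    forall x : int, s (x, 0%N) != s' (x, 0%N) ->
    exists2 y, x < y & s (y, 0%N) != s' (y, 0%N);
  generic_en : forall J, Omega J -> forall s A, A != fset0 -> en J s A != 0;
  generic_flex : forall J, Omega J -> forall s, gs J s -> forall e,
    exists2 d : R, 0 < d & forall A, cut (ind A) e -> d <= en J s A;
  generic_dense : forall J, Omega J -> forall e (a b : R), a < b ->
    exists2 t, a < t < b & Omega (upd J e t) }.

Variable Omega : set (edge -> R).
Hypothesis OmegaP : generic Omega.

Lemma nomax_unbounded (d : int -> bool) (x0 : int) : d x0 ->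
  (forall x, d x -> exists2 y, x < y & d y) -> forall b : int, exists2 y, b < y & d y.
Proof.
move=> dx0 nomax b.
have H (n : nat) : exists2 y, x0 + n%:Z <= y & d y.
  elim: n => [|n [y xy /nomax[z yz dz]]]; first by exists x0 => //; lia.
  by exists z => //; lia.
have [y xy dy] := H (absz (b - x0 + 1)).
by exists y => //; lia.
Qed.

(** If [r1 < r2], weaken [e] by an amount in between: [A0] becomes profitable in [s] while [s']
    survives. The minimizers with boundary condition [s] flip sets crossing [e] whose traces on the
    bottom row are intervals, and their limit is a ground state whose disagreement with [s'] on that
    row violates [generic_nomax]. *)
Lemma bottom_flexibility_le J s s' (i : int) (e : edge) (A0 : {fset vertex})
    (r1 r2 : R) :
  Omega J -> gs J s -> gs J s' -> (forall x, s (x, 0%N) = s' (x, 0%N)) ->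
  val e = [fset (i, 0%N); ((i + 1)%R, 0%N)]%fset ->
  cut (ind A0) e -> en J s A0 <= r1 ->
  (forall A, cut (ind A) e -> r2 <= en J s' A) -> r2 <= r1.
Proof.
move=> OJ Js Js' ss' eE A0e sA0 s'A; rewrite leNgt; apply/negP => r12.
have ue : cut s e = cut s' e by rewrite !(cut_fset2 _ eE) !ss'.
have [r [r1r rr2 OJ1]] : exists r, [/\ r1 < r, r < r2 &
    Omega (upd J e (J e - (-1) ^+ cut s e * r))].
  case: (cut s e).
    have [|t /andP[t1 t2] Ot] := generic_dense OmegaP OJ e
      (_ : J e + r1 < J e + r2); first by rewrite ltrD2l.
    exists (t - J e); split; [lra|lra|].
    by rewrite expr1 (_ : _ - _ = t)//; lra.
  have [|t /andP[t1 t2] Ot] := generic_dense OmegaP OJ e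
    (_ : J e - r2 < J e - r1); first by rewrite ltrD2l ltrN2.
  exists (J e - t); split; [lra|lra|].
  by rewrite expr0 (_ : _ - _ = t)//; lra.
set J1 := upd _ _ _ in OJ1.
have enJ1 u A : cut u e = cut s e -> en J1 u A = en J u A - (cut (ind A) e)%:R * r.
  move=> uE; rewrite en_upd uE addrAC subrr add0r mulNr -mulrA (mulrC r) mulrA.
  by rewrite -signr_addb addbb expr0 mul1r mulrN.
have J1s' : gs J1 s'.
  move=> A; rewrite enJ1 //; have := Js' A; have := s'A A.
  case: (cut _ e) => /= [/(_ isT)|_]; last by rewrite mul0r subr0.
  by rewrite mul1r; lra.
have [S0 HS] := choice (fun k => exists_stable J1 (box k) s).
have [rho rhoP] := config_cluster (fun k => flip s (S0 k)).
have J1rho : gs J1 rho.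
  by apply: (gs_limit _ rhoP) => k; have [] := HS k.
have [K0 A0K] := sub_box A0.
(* At [J1] the set [A0] has negative cost in [s], hence so has the minimizing set; sets not crossing
   [e] still have nonnegative cost. *)
have S_cut k : (K0 <= k)%N -> cut (ind (S0 k)) e.
  move=> Kk; have [_ _ /(_ A0)] := HS k.
  have A0k : {subset A0 <= box k} by move=> x /A0K; exact: box_mono.
  move=> /(_ A0k); rewrite !enJ1 // A0e mul1r.
  have := Js (S0 k); case: (cut _ e) => //=.
  by rewrite mul0r subr0; lra.
have S_conv k (a b c : int) : (K0 <= k)%N -> a < b -> b < c ->
    (a, 0%N) \in S0 k -> (c, 0%N) \in S0 k -> (b, 0%N) \in S0 k.
  move=> Kk ab bc aS cS; apply: contraT => bS.
  have [Sk st _] := HS k.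
  (* One of [X] and its symmetric difference with [S0 k] has a boundary
     avoiding [e], and flipping it would not have changed sides. *)
  have key (X : {fset vertex}) (x y : vertex) : {subset X <= box k} -> x \in X ->
      y \in symd (S0 k) X -> (forall f, cut (ind X) f -> cut (ind (S0 k)) f) -> False.
    move=> Xk xX yX XS.
    have flip0 (Y : {fset vertex}) : {subset Y <= box k} -> Y != fset0 ->
        (forall f, cut (ind Y) f -> cut (ind (S0 k)) f) -> ~~ cut (ind Y) e -> False.
      move=> Yk Y0 YS Ye; have /eqP := generic_en OmegaP OJ1 s Y0; apply.
      apply: (stable_flip_en_eq0 st Yk YS _ (Js Y)) => f fY.
      by rewrite /J1 /upd; case: eqP => // fe; rewrite fe (negbTE Ye) in fY.
    have [Xe|Xe] := boolP (cut (ind X) e); last first.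
      by apply: (flip0 X) => //; apply/fset0Pn; exists x.
    apply: (flip0 (symd (S0 k) X)).
    - by move=> z; rewrite in_symd; case: (boolP (z \in S0 k)) => [/Sk//|_ /= /Xk].
    - by apply/fset0Pn; exists y.
    - by move=> f; rewrite cut_symd; have := XS f; case: (cut (ind (S0 k)) f).
    - by rewrite cut_symd Xe S_cut.
  exfalso; have [[C [aC cC CA Cc]]|[K [bK Kc Ke]]] := bottom_trace ab bc aS cS bS.
    apply: (key C (a, 0%N) (c, 0%N)) => //; first by move=> x /CA /Sk.
    by rewrite in_symd cS (negbTE cC).
  apply: (key K (b, 0%N) (a, 0%N)) => //.
    move=> [x y] /Ke[_ [j yj] /Sk + _]; rewrite !in_box /= => /andP[-> jk].
    exact: leq_trans jk.
  rewrite in_symd aS; case: (boolP ((a, 0%N) \in K)) => // /Ke [].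
  by rewrite aS.
pose d (x : int) := rho (x, 0%N) != s' (x, 0%N).
have dP (l : seq int) : exists2 k, (K0 <= k)%N &
    forall x, x \in l -> d x = ((x, 0%N) \in S0 k).
  have [L lL] := sub_box [seq (x, 0%N) | x <- l].
  have [k Kk kL] := rhoP L K0; exists k => // x xl.
  rewrite /d -ss' -kL; last by apply/lL/mapP; exists x.
  by rewrite /flip; case: (s _); case: (_ \in _).
have d_conv a b c : a < b -> b < c -> d a -> d c -> d b.
  move=> ab bc; have [k Kk dk] := dP [:: a; b; c].
  rewrite !dk ?inE ?eqxx ?orbT // => aS cS; exact: S_conv aS cS.
have de : d i (+) d (i + 1).
  have [k Kk dk] := dP [:: i; i + 1].
  by rewrite !dk ?inE ?eqxx ?orbT // -[_ (+) _](cut_fset2 (ind (S0 k)) eE) S_cut.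
have d_nomax := generic_nomax OmegaP OJ1 J1rho J1s'.
(* If [i] is in the convex set [d], then [i + 1] is not, and [i] would be the last disagreement. *)
have [di|di] := boolP (d i); rewrite ?di ?(negbTE di) /= in de.
  have [y iy dy] := d_nomax _ di.
  have [yi|yi] := eqVneq y (i + 1); first by rewrite -yi /d dy in de.
  by move: de; rewrite (@d_conv i (i + 1) y) //; [rewrite ltrDl|exact: ltz_succ].
have dub := nomax_unbounded de d_nomax.
(* Otherwise [d] contains all sites to the right of [i], which would be the last agreement; this is
   excluded by comparing [rho] with the negation of [s']. *)
have nd : ~~ s' (i, 0%N) != rho (i, 0%N).
  by move: di; rewrite /d negbK => /eqP ->; case: (s' _).
have [y iy] := generic_nomax OmegaP OJ1 (gs_neg J1s') J1rho nd.
have [z yz dz] := dub y.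
have [yi|yi] := eqVneq y (i + 1).
  by move: de; rewrite -yi /d; case: (rho _); case: (s' _).
have : d y by apply: (@d_conv (i + 1) y z) => //; exact: ltz_succ.
by rewrite /d; case: (rho _); case: (s' _).
Qed.

End Generic.

(** * Changing couplings within the generic set *)

Section Perturbation.
Variable R : realType.
Implicit Types (J : edge -> R) (s : vertex -> bool) (A : {fset vertex}).
Variable Omega : set (edge -> R).
Hypothesis OmegaP : generic Omega.

(** A positive [h] favours [s] at [e], and favours [s'] exactly when the two states agree there.
    Only a dense set of values of [h] is available, hence the interval. *)
Lemma generic_shift J s e (a b : R) : Omega J -> a < b ->
  exists2 h, a < h < b & exists2 J', Omega J' & forall s' A,
    en J' s' A = en J s' A +
      (cut (ind A) e)%:R * (h * (-1) ^+ (cut s e (+) cut s' e)).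
Proof.
move=> OJ ab.
have [h abh Oh] : exists2 h, a < h < b &
    Omega (upd J e (J e + (-1) ^+ cut s e * h)).
  case: (cut s e).
    have [|t /andP[t1 t2] Ot] := generic_dense OmegaP OJ e
      (_ : J e - b < J e - a); first by rewrite ltrD2l ltrN2.
    exists (J e - t); first by apply/andP; split; lra.
    by rewrite expr1 (_ : _ + _ = t)//; lra.
  have [|t /andP[t1 t2] Ot] := generic_dense OmegaP OJ e
    (_ : J e + a < J e + b); first by rewrite ltrD2l.
  exists (t - J e); first by apply/andP; split; lra.
  by rewrite expr0 (_ : _ + _ = t)//; lra.
exists h => //; eexists; first exact: Oh.
move=> s' A; rewrite en_upd addrAC subrr add0r signr_addb.
by rewrite -[_ * h * _]mulrA (mulrCA _ h).
Qed.

(** On edges where the states agree, a change favourable to [s] is favourable to [s'], so its size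
    is unrestricted. *)
Lemma generic_raise J s s' (l : seq edge) (M : R) : 0 < M ->
  Omega J -> gs J s -> gs J s' -> (forall f, f \in l -> cut s f = cut s' f) ->
  exists J', [/\ Omega J', gs J' s, gs J' s',
    forall A, has (cut (ind A)) l -> M <= en J' s A &
    forall A, ~~ has (cut (ind A)) l -> en J' s A = en J s A] /\
    forall A, en J s A <= en J' s A.
Proof.
move=> M0; elim: l => [|f l IH] OJ Js Js' ll.
  by exists J; split.
have [|J1 [[OJ1 Js1 Js1' cut1 ncut1] le1]] := IH OJ Js Js'.
  by move=> g gl; apply: ll; rewrite inE gl orbT.
have M1 : M < M + 1 by rewrite ltrDl.
have [h /andP[Mh _] [J2 OJ2 enJ2]] := generic_shift s f OJ1 M1.
exists J2; have ff := ll f (mem_head _ _); split; last first.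
  move=> A; rewrite enJ2 addbb expr0 mulr1.
  by apply: (le_trans (le1 A)); rewrite lerDl mulr_ge0 ?ler0n //; lra.
split=> // A.
- by rewrite enJ2 addbb expr0 mulr1 addr_ge0 ?mulr_ge0 ?ler0n //; lra.
- by rewrite enJ2 -ff addbb expr0 mulr1 addr_ge0 ?mulr_ge0 ?ler0n //; lra.
- rewrite /= enJ2 addbb expr0 mulr1 => /orP[->|/cut1 AM].
    by rewrite mul1r; have := Js1 A; lra.
  by apply: (le_trans AM); rewrite lerDl mulr_ge0 ?ler0n //; lra.
- by rewrite /= negb_or enJ2 => /andP[/negbTE -> /ncut1 ->]; rewrite mul0r addr0.
Qed.

(** On edges where the states disagree, favouring [s] harms [s']; each shift is kept below the
    current flexibility of [s'], which therefore remains a ground state. *)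
Lemma generic_tilt J s s' (l : seq edge) :
  Omega J -> gs J s -> gs J s' -> (forall f, f \in l -> cut s f != cut s' f) ->
  exists J', [/\ Omega J', gs J' s, gs J' s', forall A, en J' s' A <= en J s' A &
    exists2 d : R, 0 < d &
      forall A, en J s A + (has (cut (ind A)) l)%:R * d <= en J' s A].
Proof.
elim: l => [|f l IH] OJ Js Js' ll.
  exists J; split => //; exists 1 => // A.
  by rewrite mul0r addr0.
have [|J1 [OJ1 Js1 Js1' le1 [d d0 dA]]] := IH OJ Js Js'.
  by move=> g gl; apply: ll; rewrite inE gl orbT.
have [u u0 uA] := generic_flex OmegaP OJ1 Js1' f.
have [h /andP[h0 hu] [J2 OJ2 enJ2]] := generic_shift s f OJ1 u0.
have ff : cut s f (+) cut s' f.
  by have := ll f (mem_head _ _); case: (cut s f); case: (cut s' f).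
exists J2; split => //.
- move=> A; rewrite enJ2 addbb expr0 mulr1 addr_ge0 ?mulr_ge0 ?ler0n //.
  exact: ltW.
- move=> A; rewrite enJ2 ff expr1 mulrN1; have := Js1' A; have := uA A.
  by case: (cut _ _) => /= [/(_ isT)|_]; rewrite ?mul1r ?mul0r ?addr0 //; lra.
- move=> A; rewrite enJ2 ff expr1 mulrN1; apply: le_trans (le1 A).
  by case: (cut _ _) => /=; rewrite ?mul1r ?mul0r ?addr0 //; lra.
- exists (Num.min d h); first by rewrite lt_min d0.
  move=> A; rewrite enJ2 addbb expr0 mulr1 /=; have := dA A.
  have md : Num.min d h <= d by rewrite ge_min lexx.
  have mh : Num.min d h <= h by rewrite ge_min lexx orbT.
  case: (cut _ f); case: (has _ _) => /=; rewrite ?mul1r ?mul0r ?addr0 //; lra.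
Qed.

End Perturbation.

Lemma adjacent_up (x : int) (y : nat) : adjacent (x, y) (x, y.+1).
Proof. by rewrite /adjacent /= subrr normr0 add0r; lia. Qed.

Lemma adjacent_right (x : int) (y : nat) : adjacent (x, y) (x + 1, y).
Proof. by rewrite /adjacent /= subrr normr0 addr0; lia. Qed.

Definition vedge x y : edge := mk_edge (adjacent_up x y).
Definition hedge x y : edge := mk_edge (adjacent_right x y).

Definition ladder (i : int) (h : nat) : seq edge :=
  [seq vedge i j | j <- iota 0 h] ++
  hedge i h :: [seq vedge (i + 1) j | j <- iota 0 h].

(** The ladder is a path joining the ends of the bottom edge, so a set separating these ends cuts it
    somewhere. *)
Lemma has_cut_ladder (P : vertex -> bool) (i : int) (h : nat) :
  cut P (hedge i 0) -> has (cut P) (ladder i h).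
Proof.
apply: contraTT; rewrite has_cat /= !negb_or !cut_mk => /and3P[Pl Pt Pr].
have column x : ~~ has (cut P) [seq vedge x j | j <- iota 0 h] ->
    forall j, (j <= h)%N -> P (x, j) = P (x, 0%N).
  move=> nP; elim=> // j IH jh; rewrite -IH; last exact: ltnW.
  apply/eqP; move: nP; apply: contraR => Pj; apply/hasP; exists (vedge x j).
    by apply/mapP; exists j => //; rewrite mem_iota.
  by rewrite cut_mk; move: Pj; case: (P _); case: (P _).
by move: Pt; rewrite (column i) // (column (i + 1)).
Qed.

Lemma cut_column (i : int) (h : nat) (f : edge) : f \in ladder i h.+1 ->
  cut (fun v => (v.1 == i) && (v.2 <= h)%N) f -> f = vedge i h.
Proof.
rewrite /ladder mem_cat (in_cons (hedge i h.+1)).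
move=> /orP[/mapP[j jh ->]|/orP[/eqP ->|/mapP[j jh ->]]]; rewrite cut_mk /=.
- rewrite eqxx /=; move: jh; rewrite mem_iota add0n /= => jh.
  by have [->|jh'] := eqVneq j h => //; lia.
- by rewrite !ltnn !andbF.
- by rewrite (_ : (i + 1 == i) = false) //; lia.
Qed.

(** * The bottom row determines a ground state *)

Section BottomRow.
Variable R : realType.
Implicit Types (J : edge -> R) (s : vertex -> bool) (A : {fset vertex}).
Variable Omega : set (edge -> R).
Hypothesis OmegaP : generic Omega.

(* By [bottom_flexibility_le] both states have the same flexibility at a bottom
   edge, whatever the couplings; but making the couplings on a ladder around
   that edge large wherever the states agree, then slightly favouring [s] where
   they disagree, increases the flexibility of [s] only. *)
Lemma bottom_row_inj J s s' : Omega J -> gs J s -> gs J s' ->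
  (forall x, s (x, 0%N) = s' (x, 0%N)) -> s = s'.
Proof.
move=> OJ Js Js' ss'; apply: contrapT => /eqP; apply/negP; rewrite negbK.
apply/eqP/funext => -[i y]; apply/eqP; apply: contraT => ny.
(* The lowest disagreement in column [i] fixes the height of the ladder. *)
have [h hP hmin] := ex_minnP (ex_intro (fun y => s (i, y) != s' (i, y)) y ny).
case: h => [|h] in hP hmin; first by rewrite ss' eqxx in hP.
have below j : (j <= h)%N -> s (i, j) = s' (i, j).
  by move=> jh; apply/eqP; apply: contraT => /hmin; rewrite ltnNge jh.
pose A0 : {fset vertex} := [fset v in [seq (i, j) : vertex | j <- iota 0 h.+1]]%fset.
have indA0 : ind A0 = (fun v => (v.1 == i) && (v.2 <= h)%N).
  apply/funext => -[x1 x2]; rewrite /ind /A0 in_fset.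
  apply/idP/idP => [/mapP[j]|/andP[/eqP x1i x2h]].
    by rewrite mem_iota => jh [-> ->] /=; rewrite eqxx; lia.
  by apply/mapP; exists x2; [rewrite mem_iota | congr pair].
have A0e : cut (ind A0) (hedge i 0).
  rewrite indA0 cut_mk /= eqxx /=; lia.
pose P := ladder i h.+1.
pose Phi := [seq f <- P | cut s f == cut s' f].
pose Gam := [seq f <- P | cut s f != cut s' f].
have PhiGam A : has (cut (ind A)) P -> has (cut (ind A)) Phi || has (cut (ind A)) Gam.
  move=> /hasP[f fP Af]; case: (boolP (cut s f == cut s' f)) => sf.
    by apply/orP; left; apply/hasP; exists f; rewrite // mem_filter sf.
  by apply/orP; right; apply/hasP; exists f; rewrite // mem_filter sf.
(* The only ladder edge crossed by [A0] ends at the lowest disagreement and so belongs to [Gam];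
   raising the couplings on [Phi] does not affect [A0]. *)
have A0Phi : ~~ has (cut (ind A0)) Phi.
  apply/hasPn => f; rewrite mem_filter => /andP[sf fP]; apply/negP.
  rewrite indA0 => /(cut_column fP) fE; move: sf hP.
  by rewrite fE !cut_mk below //; case: (s _); case: (s' _); case: (s' _).
(* With this bound, sets crossing [Phi] will cost at least 2 more than [A0]. *)
have M0 : 0 < en J s A0 + 2 by have := Js A0; lra.
have [|J2 [[OJ2 Js2 Js2' cut2 ncut2] le2]] :=
    generic_raise OmegaP M0 OJ Js Js' (l := Phi).
  by move=> f; rewrite mem_filter => /andP[/eqP].
(* [inf V] is the flexibility of [s'] at the bottom edge. *)
pose V : set R := [set r | exists2 A, cut (ind A) (hedge i 0) & r = en J2 s' A].
have V0 : lbound V 0 by move=> _ [A _ ->]; exact: Js2'.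
have Vinf : has_inf V by split; [exists (en J2 s' A0), A0|exists 0].
have infV A : cut (ind A) (hedge i 0) -> inf V <= en J2 s' A.
  by move=> Ae; apply: ge_inf; [exists 0|exists A].
have eE : val (hedge i 0) = [fset (i, 0%N); ((i + 1)%R, 0%N)]%fset by [].
have infs A : cut (ind A) (hedge i 0) -> inf V <= en J2 s A.
  move=> Ae.
  exact: (bottom_flexibility_le OmegaP OJ2 Js2 Js2' ss' eE Ae (lexx _) infV).
have [|J3 [OJ3 Js3 Js3' le3 [d d0 dA]]] := generic_tilt OmegaP OJ2 Js2 Js2' (l := Gam).
  by move=> f; rewrite mem_filter => /andP[].
(* The cap at 1 is for the sets crossing [Phi], which exceed [inf V] by 2 whatever [d] is. *)
pose d' := Num.min d 1.
have d'0 : 0 < d' by rewrite lt_min d0 ltr01.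
have d'd : d' <= d by rewrite ge_min lexx.
have d'1 : d' <= 1 by rewrite ge_min lexx orbT.
have flex3 A : cut (ind A) (hedge i 0) -> inf V + d' <= en J3 s A.
  move=> Ae; have /PhiGam/orP[AP|AG] := has_cut_ladder h.+1 Ae.
    have := cut2 A AP; have := infs A0 A0e; have := ncut2 A0 A0Phi; have := dA A.
    case: (has _ _) => /=; rewrite ?mul1r ?mul0r; lra.
  by have := dA A; rewrite AG mul1r; have := infs A Ae; lra.
have [|_ [A1 A1e ->] A1V] := @inf_adherent _ V (d' / 2) _ Vinf; first by lra.
have A1V3 : en J3 s' A1 <= inf V + d' / 2 by apply: le_trans (le3 A1) _; exact: ltW.
have s's x : s' (x, 0%N) = s (x, 0%N) by [].
have := bottom_flexibility_le OmegaP OJ3 Js3' Js3 s's eE A1e A1V3 flex3.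
lra.
Qed.

End BottomRow.

(** * Uniqueness up to a global flip *)

Definition disagree (t t' : vertex -> bool) (A : {fset vertex}) : {fset vertex} :=
  [fset x in A | t x != t' x]%fset.

Lemma in_disagree t t' A x : (x \in disagree t t' A) = (x \in A) && (t x != t' x).
Proof. by rewrite !inE. Qed.

Section Uniqueness.
Variable R : realType.
Implicit Types (J : edge -> R) (s : vertex -> bool) (A : {fset vertex}).
Variable Omega : set (edge -> R).
Hypothesis OmegaP : generic Omega.

Definition flip_equiv s s' := s' = s \/ s' = (fun x => ~~ s x).

(** A witness, visible in [box L], that the disagreement on the bottom row is not an interval. *)
Definition alternating s s' (L : nat) := exists a b c : int,
  [/\ (a < b) && (b < c),
     [&& (a, 0%N) \in box L, (b, 0%N) \in box L & (c, 0%N) \in box L] &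
     [&& s (a, 0%N) != s' (a, 0%N), s (b, 0%N) == s' (b, 0%N) &
         s (c, 0%N) != s' (c, 0%N)]].

(** Full agreement or full disagreement on the bottom row is settled by [bottom_row_inj]; otherwise
    agreements and disagreements both recur to the right without end. *)
Lemma flip_equiv_or_alternating J s s' : Omega J -> gs J s -> gs J s' ->
  flip_equiv s s' \/ exists L, alternating s s' L.
Proof.
move=> OJ Js Js'.
pose ns' x := ~~ s' x.
have Jns' : gs J ns' by exact: gs_neg.
have nsE x : (s x != ns' x) = (s x == s' x) by rewrite /ns'; case: (s x); case: (s' x).
have [[x dx]|nd] := pselect (exists x, s (x, 0%N) != s' (x, 0%N)); last first.
  left; left; apply/esym/(bottom_row_inj OmegaP OJ) => // x.
  by apply/eqP; apply: contraT => dx; exfalso; apply: nd; exists x.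
have [[y dy]|nd] := pselect (exists y, s (y, 0%N) != ns' (y, 0%N)); last first.
  left; right.
  have -> : s = ns'.
    apply: (bottom_row_inj OmegaP OJ) => // y.
    by apply/eqP; apply: contraT => dy; exfalso; apply: nd; exists y.
  by apply/funext => z; rewrite /ns' negbK.
right.
have [b xb db] := nomax_unbounded dy (generic_nomax OmegaP OJ Js Jns') x.
have [c bc dc] := nomax_unbounded dx (generic_nomax OmegaP OJ Js Js') b.
have [L HL] := sub_box [:: (x, 0%N); (b, 0%N); (c, 0%N)].
exists L, x, b, c; split; first by rewrite xb.
  by rewrite !HL // !inE eqxx ?orbT.
by rewrite dx -nsE db dc.
Qed.

Lemma alternating_mono s s' L L' : (L <= L')%N -> alternating s s' L ->
  alternating s s' L'.
Proof.
move=> LL [a [b [c [abc /and3P[aL bL cL] d]]]]; exists a, b, c; split => //.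
by rewrite !(box_mono LL).
Qed.

Lemma finite_set_bound (T : Type) (S : set T) (P : T -> nat -> Prop) :
  (forall x m n, (m <= n)%N -> P x m -> P x n) -> finite_set S ->
  (forall x, S x -> exists n, P x n) -> exists n, forall x, S x -> P x n.
Proof.
move=> Pmono; elim/Pchoice: T => T in S P Pmono *.
move=> /finite_fsetP [F ->] H.
have {}H x : x \in (F : seq T) -> exists n, P x n by move=> xF; exact: H.
suff [n nP] : exists n, forall x, x \in (F : seq T) -> P x n by exists n.
elim: (F : seq T) H => [|x l IH] H; first by exists 0%N.
have [|n nP] := IH; first by move=> y yl; apply: H; rewrite inE yl orbT.
have [m mP] := H x (mem_head _ _).
exists (maxn m n) => y; rewrite inE => /orP[/eqP ->|/nP].
  by apply: Pmono mP; exact: leq_maxl.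
by apply: Pmono; exact: leq_maxr.
Qed.

Lemma gs_alternating J : Omega J -> exists L, forall s s', gs J s -> gs J s' ->
  flip_equiv s s' \/ alternating s s' L.
Proof.
move=> OJ; have fJ := generic_finite OmegaP OJ.
have [||n nP] := @finite_set_bound _ (gs J `*` gs J)
  (fun p L => flip_equiv p.1 p.2 \/ alternating p.1 p.2 L) _ (finite_setX fJ fJ).
- move=> p m n mn [|h]; first by left.
  by right; exact: alternating_mono h.
- move=> p [/= Js Js'].
  have [fl|[L al]] := flip_equiv_or_alternating OJ Js Js'.
    by exists 0%N; left.
  by exists L; right.
by exists n => s s' Js Js'; exact: (nP (s, s')).
Qed.

Lemma stable_subset_en0 J s (S X L : {fset vertex}) : stable J L s ->
  stable J L (flip s S) -> {subset X <= L} ->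
  (forall f, cut (ind X) f -> cut (ind S) f) -> en J s X = 0.
Proof. by move=> st st' XL XS; apply: (stable_flip_en_eq0 st' XL XS) => //; exact: st. Qed.

(* Flipping a component of the set of disagreement that does not contain [v], or
   a hole of this set, changes the energies of [t] and [t'] by opposite amounts. *)
Lemma outer_site_trace J (t t' : vertex -> bool) (v : vertex) (N : nat) :
  Omega J -> stable J (box N) t -> stable J (box N) t' -> v \notin box N ->
  (forall x, x \notin box N -> x != v -> t x = t' x) -> ~ alternating t t' N.
Proof.
move=> OJ st st' vN tt' [a [b [c [/andP[ab bc] /and3P[aN bN cN] /and3P[da db dc]]]]].
pose S : {fset vertex} := disagree t t' (v |` box N)%fset.
have inS x : (x \in S) = (t x != t' x).
  rewrite in_disagree in_fset1U andb_idl // => dx; have [//|xv] := eqVneq x v.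
  by apply: contraNT dx => xN; apply/eqP; exact: tt'.
have SN x : x \in S -> x != v -> x \in box N.
  by rewrite inS => dx xv; apply: contraNT dx => xN; apply/eqP; exact: tt'.
have t'E : t' = flip t S.
  by apply/funext => x; rewrite /flip inS; case: (t x); case: (t' x).
rewrite t'E in st'.
have zero (X : {fset vertex}) (x : vertex) : {subset X <= box N} -> x \in X ->
    (forall f, cut (ind X) f -> cut (ind S) f) -> False.
  move=> XN xX XS; have X0 : X != fset0 by apply/fset0Pn; exists x.
  have /eqP := generic_en OmegaP OJ t X0; apply.
  exact: (stable_subset_en0 st st' XN XS).
have aS : (a, 0%N) \in S by rewrite inS.
have bS : (b, 0%N) \notin S by rewrite inS db.
have cS : (c, 0%N) \in S by rewrite inS.
have [[C [aC cC CS Cc]]|[K [bK Kc Ke]]] := bottom_trace ab bc aS cS bS.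
  (* Whichever of [C] and its complement in [S] avoids [v] lies in the box. *)
  have [vC|vC] := boolP (v \in C); last first.
    apply: (zero C (a, 0%N)) => // x xC.
    apply: SN (CS _ xC) _; apply: contraNneq vC => <- //.
  apply: (zero (symd S C) (c, 0%N)).
  - move=> x; rewrite in_symd; case: (boolP (x \in S)) => xS.
      by move=> /= xC; apply: SN => //; apply: contraNneq xC => ->.
    by move=> /= /CS xS'; rewrite xS' in xS.
  - by rewrite in_symd cS (negbTE cC).
  - by move=> f; rewrite cut_symd; have := Cc f; case: (cut (ind S) f).
apply: (zero K (b, 0%N)) => // -[x y] xyK; apply: contraT => xyN; exfalso.
(* If [(x, y)] were outside the box, the site of [S] above it would be [v]. Its row, followed away
   from the origin, meets [S] at another site, which lies in the box and forces [(x, y)] into it. *)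
have [xyS [j yj xjS] row] := Ke _ _ xyK.
have xjv : (x, j) == v.
  apply: contraNT xyN => /(SN _ xjS); rewrite !in_box /= => /andP[-> jN].
  exact: leq_trans jN.
have yj' : y != j by apply: contraNneq xyS => ->.
pose d : int := if 0 <= x then 1 else -1.
have d1 : d = 1 \/ d = -1 by rewrite /d; case: ifP; auto.
have [n nS] := row d d1.
have nv : (x + n%:Z * d, y) != v.
  by rewrite -(eqP xjv) xpair_eqE (negbTE yj') andbF.
move: xyN; apply/negP; rewrite negbK.
have := SN _ nS nv; rewrite !in_box /= => /andP[xn ->]; rewrite andbT.
by move: xn; rewrite /d; clear; case: ifP; lia.
Qed.

(* The boundary condition outside the box is changed from [s] to [s'] one site
   at a time; no step changes the class of the minimizer near the origin. *)
Theorem gs_unique_up_to_flip J s s' : Omega J -> gs J s -> gs J s' ->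
  flip_equiv s s'.
Proof.
move=> OJ Js Js'.
have [L altL] := gs_alternating OJ.
have [N LN attract] := box_attract J L.
pose near (t g : vertex -> bool) := forall x, x \in box L -> t x = g x.
pose bc (l : seq vertex) := foldr (fun v u => flip u [fset v]%fset) s l.
have chain l : (forall v, v \in l -> v \notin box N) ->
    exists t, [/\ stable J (box N) t, forall x, x \notin box N -> t x = bc l x &
      forall g, gs J g -> near t g -> flip_equiv s g].
  elim: l => [_|v l IH vl].
    exists s; split => //.
    move=> g Jg sg; have [//|[a [b [c [_ /and3P[aL _ _] /and3P[da _ _]]]]]] :=
      altL _ _ Js Jg.
    by rewrite sg // eqxx in da.
  have [|t [tst tbc tg]] := IH.
    by move=> u ul; apply: vl; rewrite inE ul orbT.
  have vN : v \notin box N by apply: vl; exact: mem_head.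
  have [S [SN t'st _]] := exists_stable J (box N) (bc (v :: l)).
  exists (flip (bc (v :: l)) S).
  have t'bc x : x \notin box N -> flip (bc (v :: l)) S x = bc (v :: l) x.
    by move=> xN; rewrite flip_out //; apply: contra xN => /SN.
  split => // g' Jg' tg'.
  have [g Jg gt] := attract _ tst.
  have sg := tg g Jg gt.
  have [gg'|al] := altL _ _ Jg Jg'.
    case: sg gg' => -> [] ->; rewrite /flip_equiv; auto.
    by left; apply/funext => x; rewrite negbK.
  (* [g] and [g'] alternate in [box L], where the two minimizers copy them; a change at one outer
     site does not allow this. *)
  exfalso; apply: (outer_site_trace OJ tst t'st vN).
    move=> x xN xv; rewrite t'bc // tbc //= flip_out //.
    by rewrite inE.
  have [a [b [c [abc /and3P[aL bL cL] d]]]] := al.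
  exists a, b, c; split => //; first by rewrite !(box_mono LN).
  by rewrite !gt // !tg'.
(* Costs of subsets of [box N] involve only the sites of [box N.+1]. *)
pose l := [seq x <- box N.+1 | (x \notin box N) && (s x != s' x)].
have bcl x : bc l x = s x (+) (x \in l).
  have : uniq l by rewrite filter_uniq // fset_uniq.
  rewrite /bc; elim: (l) => [|v r IH] /=; first by rewrite addbF.
  move=> /andP[vr ur]; rewrite /flip IH // in_fset1 in_cons -addbA; congr addb.
  by have [xv|_] := eqVneq x v; rewrite ?xv ?(negbTE vr) ?addbF.
have [|t [tst tbc tg]] := chain l.
  by move=> v; rewrite mem_filter => /andP[/andP[]].
apply: tg => // x xL.
have ts' y : y \in box N.+1 -> y \notin box N -> t y = s' y.
  move=> yN1 yN; rewrite tbc // bcl mem_filter yN yN1 /= andbT.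
  by case: (s y); case: (s' y).
(* Around [box N] the states [t] and [s'] coincide, so flipping [S] has opposite, nonnegative costs
   in them; genericity then makes [S] empty. *)
pose S : {fset vertex} := disagree t s' (box N).
have inS y : (y \in S) = (y \in box N) && (t y != s' y) by rewrite in_disagree.
have SN : {subset S <= box N} by move=> y; rewrite inS => /andP[].
have tS y : y \in box N.+1 -> s' y = t y (+) (y \in S).
  move=> yN1; rewrite inS; have [yN|/(ts' y yN1) ->] /= := boolP (y \in box N).
    by case: (t y); case: (s' y).
  by rewrite addbF.
have s'S : en J s' S = - en J t S.
  apply: en_opp => e eS; have /andP[se de] := cut_box SN eS.
  rewrite /cut !tS // addbACA; move: eS; rewrite /cut /ind.
  by move=> ->; rewrite addbT.
have en0 : en J t S = 0.
  apply/eqP; rewrite eq_le tst // andbT -oppr_ge0 -s'S; exact: Js'.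
have S0 : S = fset0.
  by apply/eqP; apply: contraT => /(generic_en OmegaP OJ t); rewrite en0 eqxx.
have xN : x \in box N by exact: box_mono xL.
by rewrite (tS x) ?(box_mono (leqnSn N)) // S0 inE addbF.
Qed.

Lemma ground_states_card2 J : Omega J -> ground_states J #= `I_2.
Proof.
move=> OJ; have [s Js] := gs_nonempty J.
rewrite ground_statesE.
have -> : gs J = [set s; fun x => ~~ s x].
  apply/seteqP; split=> [s' Js'|s' /= [->|->]] //; last exact: gs_neg.
  by have [->|->] := gs_unique_up_to_flip OJ Js Js'; [left|right].
have ns : spin R (fun x => ~~ s x) <> spin R s.
  by move=> /spin_inj/(congr1 (fun f => f (0, 0%N))); case: (s _).
apply/eq_cardSP; exists (spin R s); first by exists s => //; left.
rewrite (_ : _ `\ _ = [set spin R (fun x => ~~ s x)]); first exact: card_set1.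
apply/seteqP; split=> [_ [[u /= [->|->] <-] //]|_ ->].
by split => //; exists (fun x => ~~ s x) => //; right.
Qed.

End Uniqueness.

(** * The product law *)

Section Cylinders.
Variable R : realType.

Definition cyl (F : {fset edge}) (B : edge -> set (measurableTypeR R)) :
    set (couplings R) := [set J : couplings R | forall e, e \in F -> B e (J e)].

Definition cyls : set (set (couplings R)) :=
  [set C | exists F B, (forall e, measurable (B e)) /\ C = cyl F B].

Lemma measurable_coord (e : edge) :
  measurable_fun setT (fun J : couplings R => J e : measurableTypeR R).
Proof.
move=> _ B mB; rewrite setTI; apply: sub_sigma_algebra.
by exists e, B.
Qed.

Lemma measurable_cyl F B : (forall e, measurable (B e)) -> measurable (cyl F B).
Proof.
move=> mB; pose C e := (fun J : couplings R => J e : measurableTypeR R) @^-1` B e.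
have mC e : measurable (C e).
  by have := measurable_coord e measurableT (mB e); rewrite setTI.
have -> : cyl F B = \big[setI/setT]_(e <- F) C e.
  rewrite -bigcap_seq; apply/seteqP; split=> J H e eF; exact: H.
exact: bigsetI_measurable.
Qed.

Lemma measurable_cylsE : (measurable : set (set (couplings R))) = <<s cyls >>.
Proof.
apply/seteqP; split.
  apply: smallest_sub; first exact: smallest_sigma_algebra.
  move=> _ [e [B [mB ->]]]; apply: sub_sigma_algebra.
  exists [fset e]%fset, (fun=> B); split => //.
  apply/seteqP; split=> J => [JB f /fset1P -> //|JB].
  exact: (JB e (fset11 e)).
apply: smallest_sub; first exact: sigma_algebra_measurable.
by move=> _ [F [B [mB ->]]]; exact: measurable_cyl.
Qed.

Lemma cylI F B F' B' : cyl F B `&` cyl F' B' = cyl (F `|` F')%fset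
  (fun e => (if e \in F then B e else setT) `&` (if e \in F' then B' e else setT)).
Proof.
apply/seteqP; split=> J; rewrite /cyl /=.
  move=> [H H'] e _; split; case: ifP => //; [exact: H|exact: H'].
move=> H; split=> e eF; have := H e; rewrite inE eF ?orbT => /(_ isT) []//.
Qed.

Lemma setI_closed_cyls : setI_closed cyls.
Proof.
move=> _ _ [F [B [mB ->]]] [F' [B' [mB' ->]]]; rewrite cylI.
eexists; eexists; split; last by [].
by move=> e; apply: measurableI; case: ifP.
Qed.

Lemma cyl0 B : cyl fset0 B = setT.
Proof. by apply/seteqP; split=> // J _ e; rewrite inE. Qed.

Lemma measurable_couplings d (T : measurableType d) (D : set T)
    (f : T -> couplings R) : measurable D ->
  (forall e, measurable_fun D (fun x => f x e : measurableTypeR R)) ->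
  measurable_fun D f.
Proof.
move=> mD H.
refine (@measurability _ _ T (couplings R) D f (@cylinders R) erefl _).
by move=> _ [_ [e [B [mB ->]]] <-]; exact: H.
Qed.

Lemma cyls_measure_unique (m1 m2 : {measure set (couplings R) -> \bar R}) :
  (forall F B, (forall e, measurable (B e)) -> m1 (cyl F B) = m2 (cyl F B)) ->
  (m1 setT < +oo)%E -> forall A, measurable A -> m1 A = m2 A.
Proof.
move=> m12 m1T; apply: (measure_unique cyls (fun=> setT)).
- exact: measurable_cylsE.
- exact: setI_closed_cyls.
- by move=> _; exists fset0, (fun=> setT); rewrite cyl0.
- by rewrite bigcup_const.
- by move=> _ [F [B [mB ->]]]; exact: m12.
- by [].
Qed.

End Cylinders.

(** * Invariance of the product law and resampling of one coupling *)

Section ProductLaw.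
Variables (R : realType) (mu : probability (measurableTypeR R) R).
Variables (nu : probability (couplings R) R) (nu_product : product_law mu nu).

Lemma product_lawE F B : (forall e, measurable (B e)) ->
  nu (cyl F B) = (\prod_(e <- F) mu (B e))%E.
Proof. exact: nu_product. Qed.

Lemma product_law_pushforward d (T : measurableType d) (m : {measure set T -> \bar R})
    (f : T -> couplings R) : measurable_fun setT f ->
  (forall F B, (forall e, measurable (B e)) ->
     m (f @^-1` cyl F B) = (\prod_(e <- F) mu (B e))%E) ->
  forall A, measurable A -> m (f @^-1` A) = nu A.
Proof.
move=> mf mcyl A mA; apply: (cyls_measure_unique (m1 := pushforward m f)) => //.
  by move=> F B mB; exact: etrans (mcyl F B mB) (esym (product_lawE F mB)).
have := mcyl fset0 (fun=> setT) (fun=> measurableT).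
rewrite cyl0 big_seq_fset0 => mT.
by apply: (@le_lt_trans _ _ 1%E); [rewrite -mT|rewrite ltry].
Qed.

Definition resample (e : edge) (p : couplings R * measurableTypeR R) : couplings R :=
  upd p.1 e p.2.

Lemma measurable_resample (e : edge) : measurable_fun setT (resample e).
Proof.
apply: measurable_couplings => // f.
rewrite /resample /upd; case: eqP => _; first exact: measurable_snd.
exact: measurableT_comp (measurable_coord f) measurable_fst.
Qed.

Lemma resample_preserves (e : edge) (A : set (couplings R)) : measurable A ->
  (nu \x mu)%E (resample e @^-1` A) = nu A.
Proof.
apply: product_law_pushforward; first exact: measurable_resample.
move=> F B mB.
rewrite (_ : _ @^-1` _ = cyl (F `\ e)%fset B `*` (if e \in F then B e else setT)).
  have mE : measurable (if e \in F then B e else setT) by case: ifP.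
  apply: (etrans (product_measure1E nu mu (measurable_cyl (F `\ e)%fset mB) mE)).
  apply: (etrans (congr1 (fun z => (z * mu _)%E) (product_lawE (F `\ e)%fset mB))).
  case: ifPn => eF.
    by rewrite (big_fsetD1 e eF) /= muleC.
  by rewrite probability_setT mule1 mem_fsetD1.
apply/seteqP; split=> -[J t] /=; rewrite /cyl /resample /upd /=.
  move=> H; split.
    by move=> f /fsetD1P[fe fF]; have := H f fF; rewrite (negbTE fe).
  by case: ifPn => // eF; have := H e eF; rewrite eqxx.
move=> [HJ Ht] f fF; have [fe|fe] := eqVneq f e.
  by move: Ht; rewrite -fe fF.
by apply: HJ; apply/fsetD1P.
Qed.

(** Fubini: the preimage of a null set under [resample e] is null, so almost all its sections
    are. *)
Lemma resample_negligible (e : edge) (N : set (couplings R)) :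
  nu.-negligible N -> nu.-negligible [set J | ~ mu.-negligible [set t | N (upd J e t)]].
Proof.
move=> [M [mM M0 NM]].
set f := resample e.
have mf : measurable (f @^-1` M).
  by rewrite -[X in measurable X]setTI; exact: measurable_resample.
have f0 : (nu \x mu)%E (f @^-1` M) = 0%E by rewrite resample_preserves.
have mx := @measurable_fun_xsection _ _ _ _ _ mu _ mf.
have : (\int[nu]_x `|(mu \o xsection (f @^-1` M)) x|)%E = 0%E.
  rewrite -[RHS]f0 /product_measure1; apply: eq_integral => x _.
  by rewrite gee0_abs.
move=> /(ae_eq_integral_abs nu measurableT mx) ae0.
apply: negligibleS ae0 => J /= nJ aeJ; apply: nJ.
apply: (@negligibleS _ _ _ _ (xsection (f @^-1` M) J)).
  by move=> t /NM Mt; rewrite /xsection /= inE.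
apply/negligibleP; first exact: measurable_xsection.
exact: aeJ.
Qed.

End ProductLaw.

Section Resampling.
Variables (R : realType) (mu : probability (measurableTypeR R) R).
Variables (nu : probability (couplings R) R) (nu_product : product_law mu nu).

Lemma negligible_bigcup_count d (T : measurableType d) (m : {measure set T -> \bar R})
    (I : countType) (N : I -> set T) :
  (forall i, m.-negligible (N i)) -> m.-negligible (\bigcup_i N i).
Proof.
move=> H; pose N' n := if choice.unpickle n is Some i then N i else set0.
apply: (@negligibleS _ _ _ _ (\bigcup_n N' n)).
  by move=> x [i _ Nx]; exists (choice.pickle i) => //; rewrite /N' choice.pickleK.
apply: negligible_bigcup => n; rewrite /N'; case: choice.unpickle => // *.
exact: negligible_set0.
Qed.

(** One round discards the couplings that leave the current set when some edge is resampled in a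
    non-negligible set of values. The remainder need not be closed, so the rounds are iterated;
    membership in all of them survives almost every resampling. *)
Lemma resample_closure (P : set (couplings R)) : nu.-negligible (~` P) ->
  exists Omega : set (couplings R), [/\ nu.-negligible (~` Omega), Omega `<=` P &
    forall J, Omega J -> forall e,
      mu.-negligible [set t : measurableTypeR R | ~ Omega (upd J e t)]].
Proof.
move=> P0.
pose good (Q : set (couplings R)) : set (couplings R) :=
  [set J | forall e, mu.-negligible [set t : measurableTypeR R | ~ Q (upd J e t)]].
have good0 Q : nu.-negligible (~` Q) -> nu.-negligible (~` good Q).
  move=> Q0; apply: negligibleS (negligible_bigcup_count
    (fun e : edge => resample_negligible nu_product e Q0)).
  by move=> J /existsNP [e Je]; exists e.
pose Os := fix Os n := if n is k.+1 then Os k `&` good (Os k) else P.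
have Os0 n : nu.-negligible (~` Os n).
  elim: n => [//|n IH] /=; rewrite setCI; apply: negligibleU => //.
  exact: good0.
exists (\bigcap_n Os n); split.
- by rewrite setC_bigcap; apply: negligible_bigcup.
- by move=> J /(_ 0%N I).
- move=> J OJ e; apply: (@negligibleS _ _ _ _ 
    (\bigcup_n [set t : measurableTypeR R | ~ Os n (upd J e t)])).
    move=> t /= /existsNP[n /not_implyP[_ nO]]; by exists n.
  by apply: negligible_bigcup => n; have [_] := OJ n.+1 I; exact.
Qed.

(** Open intervals have positive [mu]-measure, so a null set cannot cover one. *)
Lemma negligible_dense (N : set R) (a b : R) : law_support mu = [set: R] ->
  mu.-negligible (N : set (measurableTypeR R)) -> a < b ->
  exists2 t, a < t < b & ~ N t.
Proof.
move=> supp [M [mM M0 NM]] ab; apply: contrapT => H.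
have abM : `]a, b[%classic `<=` M.
  move=> t /=; rewrite in_itv /= => tab; apply: NM; apply: contrapT => nN.
  by apply: H; exists t.
have : law_support mu ((a + b) / 2) by rewrite supp.
move=> /(_ `]a, b[%classic (@itv_open _ _ _ _)).
rewrite /= in_itv /= => H1.
have /H1 : a < (a + b) / 2 < b by apply/andP; split; lra.
apply/negP; rewrite -leNgt -M0; apply: le_measure; rewrite ?inE //.
Qed.

End Resampling.

(** * Horizontal translations *)

Section Shift.

Definition shift (k : int) (v : vertex) : vertex := (v.1 + k, v.2).

Lemma shiftK k : cancel (shift k) (shift (- k)).
Proof. by case=> x y; rewrite /shift /= addrK. Qed.

Lemma shiftNK k : cancel (shift (- k)) (shift k).
Proof. by case=> x y; rewrite /shift /= subrK. Qed.

Lemma shift_adjacent k x y : adjacent x y -> adjacent (shift k x) (shift k y).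
Proof. by rewrite /adjacent /shift /= opprD addrACA subrr addr0. Qed.

Definition shift_edge (k : int) (e : edge) : edge :=
  mk_edge (shift_adjacent k (adjacent_ends e)).

Lemma val_shift_edge k e : val (shift_edge k e) = (shift k @` val e)%fset.
Proof.
rewrite [in RHS]val_edge /=; apply/fsetP => x; apply/fset2P/imfsetP => /=.
  by move=> [->|->]; [exists (src e)|exists (dst e)]; rewrite ?fset21 ?fset22.
by move=> [y /fset2P[->|->] ->]; [left|right].
Qed.

Lemma shift_edgeK k : cancel (shift_edge k) (shift_edge (- k)).
Proof.
move=> e; apply: val_inj; rewrite !val_shift_edge; apply/fsetP => x.
apply/imfsetP/idP => /= [[_ /imfsetP[y /= ye ->] ->]|xe]; first by rewrite shiftK.
by exists (shift k x); rewrite ?shiftK //; apply/imfsetP; exists x.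
Qed.

Lemma shift_edgeNK k : cancel (shift_edge (- k)) (shift_edge k).
Proof. by move=> e; have := shift_edgeK (- k) e; rewrite opprK. Qed.

Lemma cut_shift P k e : cut P (shift_edge k e) = cut (P \o shift k) e.
Proof. by rewrite cut_mk. Qed.

Lemma shift_disjoint (F F0 : {fset edge}) : exists k : int,
  forall e, e \in F -> shift_edge k e \notin F0.
Proof.
pose vs := flatten [seq [:: src e; dst e] | e <- (F : seq edge) ++ (F0 : seq edge)].
have [L HL] := sub_box vs.
have FL e : (e \in F) || (e \in F0) -> (src e \in box L) /\ (dst e \in box L).
  move=> eF; split; apply: HL; apply/flatten_mapP; exists e;
    by rewrite ?mem_cat // !inE eqxx ?orbT.
(* A row of [box L] has [2L + 1] sites, so this translation moves the box off itself. *)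
exists (L.*2.+1%:Z) => e eF; apply/negP => eF0.
have [sL _] := FL e (introT orP (or_introl eF)).
have [] := FL (shift_edge L.*2.+1%:Z e) (introT orP (or_intror eF0)).
have : shift L.*2.+1%:Z (src e) \in val (shift_edge L.*2.+1%:Z e).
  by rewrite val_shift_edge; apply/imfsetP; exists (src e) => //; rewrite val_edge fset21.
rewrite val_edge => /fset2P[] <-; rewrite !in_box /= => h1 h2; move: sL h1 h2;
  rewrite in_box /=; lia.
Qed.

Variable R : realType.

Definition shift_couplings (k : int) (J : couplings R) : couplings R :=
  fun e => J (shift_edge k e).

Lemma measurable_shift k : measurable_fun setT (shift_couplings k).
Proof.
by apply: measurable_couplings => // e; exact: measurable_coord.
Qed.

Lemma shift_preimage_cyl k F B : shift_couplings k @^-1` cyl F B =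
  cyl (shift_edge k @` F)%fset (B \o shift_edge (- k)).
Proof.
apply/seteqP; split=> J H e /=.
  by move=> /imfsetP[/= f fF ->]; rewrite shift_edgeK; exact: H.
move=> eF; have := H (shift_edge k e); rewrite /= shift_edgeK; apply.
by apply/imfsetP; exists e.
Qed.

Lemma en_shift (J : couplings R) s k A :
  en (shift_couplings k J) (s \o shift k) A = en J s (shift k @` A)%fset.
Proof.
rewrite /en (_ : bnd (shift k @` A)%fset = (shift_edge k @` bnd A)%fset).
  rewrite big_imfset /=; last by move=> e f _ _; exact: (can_inj (shift_edgeK k)).
  by apply: eq_bigr => e _; rewrite cut_shift.
have cutE e : cut (ind (shift k @` A)%fset) (shift_edge k e) = cut (ind A) e.
  rewrite cut_shift; congr cut; apply/funext => x; rewrite /ind /=.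
  by rewrite mem_imfset //; exact: can_inj (shiftK k).
apply/fsetP => e; rewrite in_bnd -[e](shift_edgeNK k) cutE mem_imfset //=.
  by rewrite in_bnd.
exact: can_inj (shift_edgeK k).
Qed.

Lemma gs_shift (J : couplings R) s k :
  gs (shift_couplings k J) (s \o shift k) <-> gs J s.
Proof.
split=> H A; last by rewrite en_shift.
have := H (shift (- k) @` A)%fset; rewrite en_shift; congr (_ <= en _ _ _).
apply/fsetP => x; apply/imfsetP/idP => /= [[_ /imfsetP[y /= ye ->] ->]|xe].
  by rewrite shiftNK.
by exists (shift (- k) x); rewrite ?shiftNK //; apply/imfsetP; exists x.
Qed.

Variable mu : probability (measurableTypeR R) R.
Variables (nu : probability (couplings R) R) (nu_product : product_law mu nu).

Lemma shift_preserves k A : measurable A -> nu (shift_couplings k @^-1` A) = nu A.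
Proof.
apply: (product_law_pushforward nu_product); first exact: measurable_shift.
move=> F B mB; rewrite shift_preimage_cyl.
apply: (etrans (product_lawE nu_product _ _)); first by move=> e; exact: mB.
rewrite big_imfset /=; last by move=> e f _ _; exact: (can_inj (shift_edgeK k)).
by apply: eq_bigr => e _; rewrite shift_edgeK.
Qed.

End Shift.

(** * Mixing and the zero-one law *)

Lemma setDIl_distr (T : Type) (A B C : set T) :
  (A `\` B) `&` C = (A `&` C) `\` (B `&` C).
Proof.
apply/seteqP; split=> x /=; first by move=> [[Ax nB] Cx]; split=> // -[].
by move=> [[Ax Cx] nBC]; split => //; split => // Bx; exact: nBC.
Qed.

Section ZeroOne.
Variables (R : realType) (mu : probability (measurableTypeR R) R).
Variables (nu : probability (couplings R) R) (nu_product : product_law mu nu).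

Let p (A : set (couplings R)) : R := fine (nu A).

Let pE A : measurable A -> nu A = (p A)%:E.
Proof. by move=> mA; rewrite fineK //; exact: fin_num_measure. Qed.

Let p_le A B : measurable A -> measurable B -> A `<=` B -> p A <= p B.
Proof.
by move=> mA mB AB; rewrite -lee_fin -!pE //; apply: le_measure; rewrite ?inE.
Qed.

Let p_ge0 A : 0 <= p A.
Proof. by apply: fine_ge0; exact: measure_ge0. Qed.

Let p_le1 A : measurable A -> p A <= 1.
Proof. by move=> mA; rewrite -lee_fin -pE //; exact: probability_le1. Qed.

Let pD A B : measurable A -> measurable B -> B `<=` A -> p (A `\` B) = p A - p B.
Proof.
move=> mA mB BA; apply: EFin_inj; rewrite EFinB -!pE //; last exact: measurableD.
by rewrite measureD // ?setIidr // -ge0_fin_numE // fin_num_measure.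
Qed.

Lemma cyls_independent F F0 B B0 : (forall e, measurable (B e)) ->
  (forall e, measurable (B0 e)) -> (forall e, e \in F -> e \notin F0) ->
  nu (cyl F0 B0 `&` cyl F B) = (nu (cyl F0 B0) * nu (cyl F B))%E.
Proof.
move=> mB mB0 FF0.
have -> : cyl F0 B0 `&` cyl F B =
    cyl (F0 `|` F)%fset (fun e => if e \in F0 then B0 e else B e).
  apply/seteqP; split=> J; rewrite /cyl /=.
    by move=> [H0 H] e; rewrite in_fsetU; case: ifPn => [/H0//|_ /= /H].
  move=> H; split=> e eF; have := H e; rewrite in_fsetU eF ?orbT => /(_ isT).
    by [].
  by rewrite (negbTE (FF0 e eF)).
rewrite !(product_lawE nu_product) //; last by move=> e; case: ifP.
rewrite (perm_big ((F0 : seq edge) ++ F)) /=; last first.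
  apply: uniq_perm; [exact: fset_uniq| |by move=> e; rewrite in_fsetU mem_cat].
  rewrite cat_uniq !fset_uniq andbT /=; apply/hasPn => e; exact: FF0.
rewrite big_cat /=.
congr (_ * _)%E; apply: eq_big_seq => e eF; first by rewrite eF.
by rewrite (negbTE (FF0 e eF)).
Qed.

(** Near independence from all cylinders based outside a finite set of edges, uniformly in the
    cylinder. *)
Let mixing (C : set (couplings R)) := forall eps : R, 0 < eps ->
  exists F0 : {fset edge}, forall F B, (forall e, measurable (B e)) ->
    (forall e, e \in F -> e \notin F0) ->
    `|p (C `&` cyl F B) - p C * p (cyl F B)| <= eps.

(** Cylinders are exactly independent of those on disjoint edges, and mixing passes to proper
    differences and increasing unions, so the pi-lambda theorem applies. *)
Lemma measurable_mixing C : measurable C -> mixing C.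
Proof.
move=> mC.
suff : measurable C /\ mixing C by case.
move: C mC.
change (measurable `<=` [set C | measurable C /\ mixing C]).
rewrite {1}measurable_cylsE.
have lam : lambda_system setT [set C : set (couplings R) | measurable C /\ mixing C].
  split=> //.
  - split=> // eps eps0; exists fset0 => F B mB _.
    by rewrite setTI /p probability_setT /= mul1r subrr normr0 ltW.
  - move=> A B BA [mA mixA] [mB mixB]; split; first exact: measurableD.
    move=> eps eps0; have eps2 : 0 < eps / 2 by lra.
    have [FA HA] := mixA _ eps2; have [FB HB] := mixB _ eps2.
    exists (FA `|` FB)%fset => F C mC FF.
    have mF := measurable_cyl F mC.
    have FAF e : e \in F -> e \notin FA.
      by move=> /FF; rewrite in_fsetU negb_or => /andP[].
    have FBF e : e \in F -> e \notin FB.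
      by move=> /FF; rewrite in_fsetU negb_or => /andP[].
    rewrite setDIl_distr pD; [|exact: measurableI|exact: measurableI|exact: setSI].
    rewrite pD //.
    have := HA F C mC FAF; have := HB F C mC FBF; rewrite !ler_norml.
    move=> /andP[? ?] /andP[? ?]; apply/andP; split; lra.
  - move=> A ndA HA.
    have mA n : measurable (A n) by have [] := HA n.
    have mUA : measurable (\bigcup_n A n) by exact: bigcup_measurable.
    split => // eps eps0; have eps3 : 0 < eps / 3 by lra.
    have [n Hn] : exists n, p (\bigcup_n A n) - p (A n) <= eps / 3.
      have cvgA := nondecreasing_cvg_mu mA mUA ndA.
      have : (nu \o A) n @[n --> \oo] --> (p (\bigcup_n A n))%:E.
        by rewrite -(pE mUA); exact: cvgA.
      move=> /fine_cvgP[_ /cvgrPdist_le /(_ _ eps3) [n _ /(_ n (leqnn n))]].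
      rewrite /= => Hn; exists n; apply: le_trans Hn; exact: ler_norm.
    have [F0 HF0] := (HA n).2 _ eps3.
    exists F0 => F B mB FF0; have mF := measurable_cyl F mB.
    have := HF0 F B mB FF0; rewrite !ler_norml => /andP[h1 h2].
    have AnU : A n `<=` \bigcup_n A n by exact: bigcup_sup.
    have l1 : p (A n `&` cyl F B) <= p (\bigcup_n A n `&` cyl F B).
      by apply: p_le; [exact: measurableI|exact: measurableI|exact: setSI].
    have l2 : p (\bigcup_n A n `&` cyl F B) - p (A n `&` cyl F B) <=
        p (\bigcup_n A n) - p (A n).
      rewrite -!pD //; try exact: measurableI; last exact: setSI.
      apply: p_le; [by apply: measurableD; exact: measurableI|exact: measurableD|].
      by rewrite -setDIl_distr; exact: subIsetl.
    have l3 : 0 <= (p (\bigcup_n A n) - p (A n)) * p (cyl F B) <=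
        p (\bigcup_n A n) - p (A n).
      have l4 : 0 <= p (\bigcup_n A n) - p (A n) by rewrite subr_ge0; exact: p_le.
      by rewrite mulr_ge0 //= ler_piMr // p_le1.
    move: l3 => /andP[]; rewrite mulrBl => l3 l4.
    apply/andP; split; lra.
apply: (lambda_system_subset (@setI_closed_cyls R) lam) => //.
move=> _ [F0 [B0 [mB0 ->]]]; split; first exact: measurable_cyl.
move=> eps eps0; exists F0 => F B mB FF0.
rewrite (_ : p _ = p (cyl F0 B0) * p (cyl F B)) ?subrr ?normr0 ?ltW //.
have mF := measurable_cyl F mB; have mF0 := measurable_cyl F0 mB0.
apply: EFin_inj; rewrite EFinM -!pE //; first exact: cyls_independent.
exact: measurableI.
Qed.

(** Translating a cylinder far away changes neither its probability nor that of its intersection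
    with [E]; by mixing, [E] is independent of every cylinder, hence of itself. *)
Lemma shift_invariant_01 E : measurable E ->
  (forall k, shift_couplings k @^-1` E = E) -> nu E = 0%E \/ nu E = 1%E.
Proof.
move=> mE invE.
have indep F B : (forall e, measurable (B e)) ->
    p (E `&` cyl F B) = p E * p (cyl F B).
  move=> mB; apply/eqP; rewrite -subr_eq0 -normr_le0; apply/ler_addgt0Pl => eps eps0.
  rewrite addr0; have [F0 HF0] := measurable_mixing mE eps0.
  have [k Fk] := shift_disjoint F F0.
  have mB' e : measurable ((B \o shift_edge (- k)) e) by exact: mB.
  have mF := measurable_cyl F mB.
  have := HF0 (shift_edge k @` F)%fset _ mB'.
  rewrite -shift_preimage_cyl -{1}(invE k) -preimage_setI /p.
  rewrite !(shift_preserves nu_product) //; last exact: measurableI.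
  by apply=> _ /imfsetP[/= f /Fk fF0 ->].
have EE : p E = p E * p E.
  pose m1 := mrestr nu mE.
  pose m2 := mscale (NngNum (p_ge0 E)) nu.
  have m12 A : measurable A -> m1 A = m2 A.
    apply: cyls_measure_unique => [F B mB|].
      have mF := measurable_cyl F mB.
      change (nu (cyl F B `&` E) = (p E)%:E * nu (cyl F B))%E.
      rewrite setIC pE; last exact: measurableI.
      by rewrite indep // EFinM -(pE mF).
    change (nu (setT `&` E) < +oo)%E.
    by rewrite setTI; apply: le_lt_trans (ltry 1); exact: probability_le1.
  have : (nu (E `&` E) = (p E)%:E * nu E)%E := m12 E mE.
  by rewrite setIid pE // -EFinM => -[].
have : p E * (1 - p E) = 0 by lra.
move=> /eqP; rewrite mulf_eq0 subr_eq0 => /orP[/eqP pE0|/eqP pE1].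
  by left; rewrite pE // pE0.
by right; rewrite pE // -pE1.
Qed.

End ZeroOne.

(** * Measurability of events on ground states *)

Section Measurability.
Variable R : realType.

Lemma measurable_bigcup_count d (T : measurableType d) (I : countType)
    (F : I -> set T) : (forall i, measurable (F i)) -> measurable (\bigcup_i F i).
Proof.
move=> mF; pose F' n := if choice.unpickle n is Some i then F i else set0.
rewrite (_ : \bigcup_i F i = \bigcup_n F' n).
  by apply: bigcup_measurable => n _; rewrite /F'; case: choice.unpickle.
apply/seteqP; split=> x [i _ Fx].
  by exists (choice.pickle i) => //; rewrite /F' choice.pickleK.
by move: Fx; rewrite /F'; case: choice.unpickle => // j Fx; exists j.
Qed.

Lemma measurable_bigcap_count d (T : measurableType d) (I : countType)
    (F : I -> set T) : (forall i, measurable (F i)) -> measurable (\bigcap_i F i).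
Proof.
move=> mF; rewrite -[X in measurable X]setCK setC_bigcap.
by apply: measurableC; apply: measurable_bigcup_count => i; exact: measurableC.
Qed.

Lemma measurable_cst_prop d (T : measurableType d) (P : Prop) :
  measurable [set _ : T | P].
Proof.
have [p|np] := pselect P.
  rewrite (_ : [set _ | P] = setT); first exact: measurableT.
  by apply/seteqP; split.
rewrite (_ : [set _ | P] = set0); first exact: measurable0.
by apply/seteqP; split.
Qed.

Lemma measurable_en s A :
  measurable_fun setT (fun J : couplings R => en J s A : measurableTypeR R).
Proof.
apply: measurable_sum => e; apply: measurable_funM => //.
exact: measurable_coord.
Qed.

Lemma measurable_en_le s A (r : R) : measurable [set J : couplings R | en J s A <= r].
Proof.
have := measurable_en s A measurableT (measurable_itv `]-oo, r]).
by rewrite setTI.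
Qed.

Lemma measurable_en_ge s A (r : R) : measurable [set J : couplings R | r <= en J s A].
Proof.
have := measurable_en s A measurableT (measurable_itv `[r, +oo[).
rewrite setTI; congr measurable; apply/seteqP.
by split=> J; rewrite /= in_itv /= andbT.
Qed.

Implicit Types (s u : vertex -> bool).

Definition agree (L : nat) s u := forall x, x \in box L -> s x = u x.

(** A finite stand-in for [s] on a box; finite sets of sites, unlike configurations, are countable
    in number. *)
Definition in_box_set s L : {fset vertex} :=
  [fset x in box L | s x]%fset.

Lemma agree_in_box_set s L : agree L s (ind (in_box_set s L)).
Proof.
move=> x xL; rewrite /ind /in_box_set; move: xL; case: (box L) => l i xl.
by rewrite !inE xl.
Qed.

(* Compactness of the space of configurations turns an existential quantifier
   over pairs of ground states into countably many set operations. *)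
Lemma measurable_exists_gs2 (E : nat -> couplings R -> (vertex -> bool) ->
    (vertex -> bool) -> Prop) :
  (forall n, exists L, forall J s s' u u', agree L s u -> agree L s' u' ->
     E n J s s' -> E n J u u') ->
  (forall n s s', measurable [set J : couplings R | E n J s s']) ->
  measurable [set J : couplings R | exists s s',
    [/\ gs J s, gs J s' & forall n, E n J s s']].
Proof.
move=> /choice[L EL] mE.
pose Q (n : nat) (J : couplings R) s s' :=
  [/\ stable J (box n) s, stable J (box n) s' & forall m, (m <= n)%N -> E m J s s'].
have mstable A s : measurable [set J : couplings R | stable J A s].
  rewrite (_ : [set _ | _] = \bigcap_(B : {fset vertex})
      [set J : couplings R | {subset B <= A} -> 0 <= en J s B]).
    apply: measurable_bigcap_count => B.
    have [BA|nBA] := pselect {subset B <= A}.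
      rewrite (_ : [set _ | _] = [set J : couplings R | 0 <= en J s B]).
        exact: measurable_en_ge.
      by apply/seteqP; split=> J /= => [/(_ BA)|].
    rewrite (_ : [set _ | _] = setT); first exact: measurableT.
    by apply/seteqP; split => // J _ /= /nBA.
  by apply/seteqP; split=> J H B; have := H B => // /(_ I).
have mQ n s s' : measurable [set J : couplings R | Q n J s s'].
  rewrite (_ : [set J : couplings R | Q n J s s'] =
      [set J : couplings R | stable J (box n) s] `&`
      [set J : couplings R | stable J (box n) s'] `&`
      \bigcap_(m in `I_n.+1) [set J : couplings R | E m J s s']).
    apply: measurableI; first exact: measurableI.
    by apply: bigcap_measurable => [|m _]; [exists 0%N|exact: mE].
  apply/seteqP; split=> J /=; first by move=> [Js Js' H]; do !split.
  by move=> [[Js Js'] H]; split => // m mn; exact: H.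
rewrite (_ : [set J : couplings R | _] =
    \bigcap_(n : nat) \bigcup_(p : {fset vertex} * {fset vertex})
    [set J : couplings R | Q n J (ind p.1) (ind p.2)]).
  by apply: measurable_bigcap_count => n; apply: measurable_bigcup_count => p; exact: mQ.
apply/seteqP; split=> J /=.
  move=> [s [s' [Js Js' H]]] n _.
  (* Large enough for [box n] with its boundary and for the windows of all conditions up to [n]. *)
  pose M := (n.+1 + \max_(m < n.+1) L m)%N.
  have LM m : (m <= n)%N -> (L m <= M)%N.
    move=> mn; apply: leq_trans (leq_addl _ _).
    exact: (@leq_bigmax _ (fun m : 'I_n.+1 => L m) (Ordinal (mn : (m < n.+1)%N))).
  have sM := @agree_in_box_set s M; have sM' := @agree_in_box_set s' M.
  exists (in_box_set s M, in_box_set s' M) => //; split=> /=.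
  - move=> B Bn; rewrite -(eq_en_box J (A := B) (L := n) (s := s)) //.
    by move=> x xn; apply: sM; apply: box_mono xn; rewrite leq_addr.
  - move=> B Bn; rewrite -(eq_en_box J (A := B) (L := n) (s := s')) //.
    by move=> x xn; apply: sM'; apply: box_mono xn; rewrite leq_addr.
  - move=> m mn; apply: EL (H m) => x xm.
      by apply: sM; apply: box_mono xm; exact: LM.
    by apply: sM'; apply: box_mono xm; exact: LM.
move=> H; have {}H n : exists p : {fset vertex} * {fset vertex},
    Q n J (ind p.1) (ind p.2) by have [p _ Qp] := H n I; exists p.
have [f fQ] := choice H.
have [s [s' ss']] := config_cluster2 (fun n => ind (f n).1) (fun n => ind (f n).2).
exists s, s'; split.
- apply: (@gs_limit _ _ (fun n => ind (f n).1)) => [k|M N]; first by have [] := fQ k.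
  by have [k Nk kM] := ss' M N; exists k => // x /kM[].
- apply: (@gs_limit _ _ (fun n => ind (f n).2)) => [k|M N]; first by have [] := fQ k.
  by have [k Nk kM] := ss' M N; exists k => // x /kM[].
- move=> n; have [k nk kL] := ss' (L n) n; have [_ _ /(_ n nk)] := fQ k.
  by apply: EL => x /kL[].
Qed.

Definition finite_gs : set (couplings R) := [set J : couplings R | finite_set (gs J)].

(** Finiteness means that some box determines the ground state: finitely many states are separated
    by a box, and a box carries finitely many patterns. *)
Lemma finite_gsE : finite_gs = \bigcup_(L : nat) \bigcap_(x : vertex)
  ~` [set J : couplings R | exists s s', [/\ gs J s, gs J s' &
       forall n : nat, agree L s s' /\ s x != s' x]].
Proof.
apply/seteqP; split=> J.
  move=> fJ.
  have [||L HL] := @finite_set_bound _ (gs J `*` gs J)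
    (fun p L => agree L p.1 p.2 -> p.1 = p.2) _ (finite_setX fJ fJ).
  - by move=> p m n mn H pn; apply: H => x xm; apply: pn; exact: box_mono xm.
  - move=> [s s'] _ /=; have [ss'|nss'] := pselect (s = s'); first by exists 0%N.
    have /existsNP[x sx] : ~ forall x, s x = s' x by move=> /funext.
    have [L HL] := sub_box [:: x]; exists L => sL; exfalso; apply: sx.
    by apply: sL; apply: HL; rewrite inE.
  - exists L => // x _ [s [s' [Js Js' /(_ 0%N)[sL]]]].
    by have /= -> := HL (s, s') (conj Js Js') sL; rewrite eqxx.
move=> [L _ HL].
have inj s s' : gs J s -> gs J s' -> agree L s s' -> s = s'.
  move=> Js Js' sL; apply: contrapT => nss'.
  have /existsNP[x sx] : ~ forall x, s x = s' x by move=> /funext.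
  by apply: (HL x I); exists s, s'; split => // _; split => //; apply/eqP.
apply: (@sub_finite_set _ _ ((fun S : {fset vertex} =>
    get [set s | gs J s /\ agree L (ind S) s]) @` [set` fpowerset (box L)])).
  move=> s Js; exists (in_box_set s L) => /=.
    rewrite fpowersetE; apply/fsubsetP => x; rewrite /in_box_set.
    by case: (box L) => l i; rewrite !inE => /andP[].
  have sP : [set u | gs J u /\ agree L (ind (in_box_set s L)) u] s.
    by split => // x xL; rewrite -agree_in_box_set.
  have [Ju uL] := getI sP.
  by apply: inj => // x xL; rewrite -uL // -agree_in_box_set.
by apply: finite_image; exact: finite_fset.
Qed.

Lemma measurable_finite_gs : measurable finite_gs.
Proof.
rewrite finite_gsE; apply: measurable_bigcup_count => L.
apply: measurable_bigcap_count => x; apply: measurableC.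
apply: measurable_exists_gs2 => [n|n s s']; last exact: measurable_cst_prop.
have [M HM] := sub_box [:: x]; exists (L + M)%N => J s s' u u' su su' [sL sx].
have xM : x \in box (L + M).
  by apply: box_mono (HM x _); [exact: leq_addl|rewrite inE].
split; last by rewrite -su // -su'.
move=> y yL; have yM : y \in box (L + M) by apply: box_mono yL; exact: leq_addr.
by rewrite -su // -su' // sL.
Qed.

Lemma finite_gs_shift k : shift_couplings k @^-1` finite_gs = finite_gs.
Proof.
apply/seteqP; split=> J fJ; rewrite /finite_gs /=.
  apply: (sub_finite_set _ (finite_image (fun s => s \o shift (- k)) fJ)).
  move=> s Js; exists (s \o shift k); first exact/gs_shift.
  by apply/funext => x /=; rewrite shiftNK.
apply: (sub_finite_set _ (finite_image (fun s => s \o shift k) fJ)).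
move=> s Js; exists (s \o shift (- k)).
  apply/(gs_shift J _ k); congr gs : Js; apply/funext => x /=.
  by rewrite shiftK.
by apply/funext => x /=; rewrite shiftK.
Qed.

End Measurability.

(** * Almost sure properties *)

(** Otherwise the whole column above a site of [A] would stay in [A]. *)
Lemma exists_cut (A : {fset vertex}) : A != fset0 -> exists e, cut (ind A) e.
Proof.
move=> /fset0Pn[[x y] xyA]; apply: contrapT => H.
have up n : (x, (y + n)%N) \in A.
  elim: n => [|n IH]; first by rewrite addn0.
  apply: contraT => nA; exfalso; apply: H; exists (vedge x (y + n)).
  by rewrite cut_mk /ind IH -addnS (negbTE nA).
have [L AL] := sub_box A.
by have := AL _ (up L.+1); rewrite in_box /=; lia.
Qed.

Section AlmostSure.
Variables (R : realType) (mu : probability (measurableTypeR R) R).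
Variables (nu : probability (couplings R) R) (nu_product : product_law mu nu).
Hypothesis mu_atomless : atomless mu.
Hypothesis mu_support : law_support mu = [set: R].

Lemma resample_null (A : set (couplings R)) (e : edge) : measurable A ->
  nu.-negligible [set J : couplings R |
    ~ mu.-negligible [set t : measurableTypeR R | A (upd J e t)]] -> nu A = 0%E.
Proof.
move=> mA A0; rewrite -(resample_preserves nu_product e mA) /product_measure1.
have mf : measurable (resample (R := R) e @^-1` A).
  by rewrite -[X in measurable X]setTI; exact: measurable_resample.
have mx := @measurable_fun_xsection _ _ _ _ _ mu _ mf.
rewrite -[RHS]((ae_eq_integral_abs nu measurableT mx).2 _).
  by apply: eq_integral => x _; rewrite gee0_abs.
apply: negligibleS A0 => J /= nJ aeJ; apply: nJ => _ /=.
apply/negligibleP; first exact: measurable_xsection.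
apply: negligibleS aeJ => t; rewrite /xsection /= inE //.
Qed.

Lemma finite_negligible (D : set (measurableTypeR R)) : finite_set D ->
  mu.-negligible D.
Proof.
move=> /finite_fsetP[F ->].
suff H (l : seq R) : mu.-negligible ([set` l] : set (measurableTypeR R)).
  exact: H.
elim: l => [|x l IH].
  by apply: negligibleS (negligible_set0 mu).
apply: (@negligibleS _ _ _ _ (([set x] `|` [set` l]) : set (measurableTypeR R))).
  by move=> y /=; rewrite inE => /orP[/eqP ->|yl]; [left|right].
apply: negligibleU => //; apply/negligibleP => //.
exact: mu_atomless.
Qed.

(** For a given set and pattern, the cost is affine with slope 1 or -1 in the coupling of a boundary
    edge, so it vanishes for one value of it. Countably many patterns suffice. *)
Lemma en_neq0_ae : nu.-negligible (~` [set J : couplings R |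
  forall s A, A != fset0 -> en J s A != 0]).
Proof.
apply: (@negligibleS _ _ _ _ (\bigcup_(p : {fset vertex} * {fset vertex})
    [set J : couplings R | p.2 != fset0 /\ en J (ind p.1) p.2 = 0])).
  move=> J /existsNP[s /existsNP[A /not_implyP[A0 /negP]]].
  rewrite negbK => /eqP sA; have [L AL] := sub_box A.
  exists (in_box_set s L.+1, A) => //; split => //=.
  rewrite -sA; apply: eq_en_box AL _ => x xL; exact/esym/agree_in_box_set.
apply: negligible_bigcup_count => -[S A] /=.
have [A0|A0] := boolP (A != fset0); last first.
  by apply: negligibleS (negligible_set0 nu) => J [].
have [e eA] := exists_cut A0.
apply: (@negligibleS _ _ _ _ ([set J : couplings R | en J (ind S) A <= 0] `&`
                              [set J : couplings R | 0 <= en J (ind S) A])).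
  by move=> J [_ JA]; split; rewrite /= JA.
have mE : measurable ([set J : couplings R | en J (ind S) A <= 0] `&`
                      [set J : couplings R | 0 <= en J (ind S) A]).
  by apply: measurableI; [exact: measurable_en_le|exact: measurable_en_ge].
apply/(negligibleP _ mE); apply: (resample_null (e := e)) => //.
apply: negligibleS (negligible_set0 nu) => J; apply.
apply: (@negligibleS _ _ _ _
  ([set J e - (-1) ^+ cut (ind S) e * en J (ind S) A] : set (measurableTypeR R))).
  move=> t [h1 h2]; have /eqP : en (upd J e t) (ind S) A == 0 by rewrite eq_le h1 h2.
  rewrite en_upd eA mul1r /=.
  by case: (cut (ind S) e); rewrite ?expr0 ?expr1; lra.
exact: finite_negligible.
Qed.

Hypothesis fin0 : nu.-negligible (~` @finite_gs R).

(** The condition is spread over [n] so that each clause looks at finitely many sites, as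
    [measurable_exists_gs2] requires. *)
Let last_diff (x : int) : set (couplings R) := [set J : couplings R |
  exists s s', [/\ gs J s, gs J s' & forall n : nat,
    s (x, 0%N) != s' (x, 0%N) /\ s (x + n.+1%:Z, 0%N) = s' (x + n.+1%:Z, 0%N)]].

Let measurable_last_diff x : measurable (last_diff x).
Proof.
apply: measurable_exists_gs2 => [n|n s s']; last exact: measurable_cst_prop.
have [L HL] := sub_box [:: (x, 0%N); (x + n.+1%:Z, 0%N)].
have xL : (x, 0%N) \in box L by apply: HL; rewrite inE eqxx.
have yL : (x + n.+1%:Z, 0%N) \in box L by apply: HL; rewrite !inE eqxx orbT.
by exists L => J s s' u u' su su'; rewrite !su // !su'.
Qed.

Let last_diff_shift x k : nu (last_diff (x + k)) = nu (last_diff x).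
Proof.
rewrite -(shift_preserves nu_product k (measurable_last_diff x)); congr (nu _).
apply/seteqP; split=> J /= [s [s' [Js Js' H]]].
  exists (s \o shift k), (s' \o shift k); split; [exact/gs_shift|exact/gs_shift|].
  by move=> n; have := H n; rewrite /shift /= addrAC.
exists (s \o shift (- k)), (s' \o shift (- k)).
have E (u : vertex -> bool) : (u \o shift (- k)) \o shift k = u.
  by apply/funext => v /=; rewrite shiftK.
split; [by apply/(gs_shift J _ k); rewrite E|by apply/(gs_shift J _ k); rewrite E|].
move=> n; have := H n; rewrite /shift /= addrK (_ : x + k + _ - k = x + n.+1%:Z) //.
by rewrite addrAC addrK.
Qed.

(* Each pair of ground states has at most one last difference, so that only
   finitely many of these equiprobable events occur. *)
Lemma last_diff_null x : nu (last_diff x) = 0%E.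
Proof.
pose K (n : nat) := last_diff n%:Z.
have mK n : measurable (K n) by exact: measurable_last_diff.
have nuK n : nu (K n) = nu (last_diff x).
  by rewrite -(last_diff_shift x (n%:Z - x)) addrC subrK.
have K0 : nu (lim_sup_set K) = 0%E.
  apply: measure_negligible.
    apply: bigcap_measurable => // n _; apply: bigcup_measurable => k _; exact: mK.
  apply: negligibleS fin0 => J Jsup fJ.
  pose D := [set n | K n J].
  have Dfin : finite_set D.
    pose last_at (q : (vertex -> bool) * (vertex -> bool)) (n : nat) := forall m : nat,
      q.1 (n%:Z, 0%N) != q.2 (n%:Z, 0%N) /\
      q.1 (n%:Z + m.+1%:Z, 0%N) = q.2 (n%:Z + m.+1%:Z, 0%N).
    have inj q n n' : last_at q n -> last_at q n' -> n = n'.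
      wlog nn' : n n' / (n < n')%N.
        by move=> W h h'; have [/W->|/W/(_ h' h)|] := ltngtP n n'.
      move=> /(_ (n' - n.+1)%N)[_ e1] /(_ 0%N)[e2 _]; move: e2.
      have -> : n'%:Z = n%:Z + (n' - n.+1).+1%:Z by lia.
      by rewrite e1 eqxx.
    apply: (@sub_finite_set _ _ ((fun q => xget 0%N (last_at q)) @` (gs J `*` gs J))).
      move=> n [s [s' [Js Js' H]]]; exists (s, s') => //.
      have Hn : last_at (s, s') n by [].
      exact: inj (xgetI 0%N Hn) Hn.
    by apply: finite_image; exact: finite_setX.
  have [M HM] : exists M : nat, forall n, D n -> (n <= M)%N.
    move: Dfin => /finite_fsetP[F DF].
    exists (\max_(n <- F) n)%N => n; rewrite DF => nF.
    exact: (@leq_bigmax_seq _ _ xpredT id).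
  have [k /= Mk Kk] := Jsup M.+1 I.
  by have := HM k Kk; rewrite leqNgt Mk.
have mU n : measurable (\bigcup_(k in [set k | (n <= k)%N]) K k).
  by apply: bigcup_measurable => k _; exact: mK.
have cvgK := lim_sup_set_cvg nu K mK.
have {}cvgK := cvgK (le_lt_trans (probability_le1 nu (mU 0%N)) (ltry 1)).
(* The common probability is at most that of every tail union, and these tend to the null limit
   superior. *)
apply/eqP; rewrite eq_le measure_ge0 andbT -K0; apply: cvge_ge cvgK.
apply: nearW => n; rewrite -(nuK n); apply: le_measure; rewrite ?inE //.
by apply: bigcup_sup => /=.
Qed.

Lemma nomax_ae : nu.-negligible (~` [set J : couplings R |
  forall s s', gs J s -> gs J s' -> forall x : int, s (x, 0%N) != s' (x, 0%N) ->
    exists2 y, x < y & s (y, 0%N) != s' (y, 0%N)]).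
Proof.
apply: (@negligibleS _ _ _ _ (\bigcup_x last_diff x)); last first.
  apply: negligible_bigcup_count => x.
  by apply/negligibleP => //; exact: last_diff_null.
move=> J /existsNP[s /existsNP[s' /not_implyP[Js /not_implyP[Js' ]]]].
move=> /existsNP[x /not_implyP[dx nx]].
exists x => //; exists s, s'; split=> // n; split=> //.
apply/eqP; apply: contraT => dy; exfalso; apply: nx.
by exists (x + n.+1%:Z) => //; rewrite ltrDl.
Qed.

Let flexible (J : couplings R) (e : edge) s := exists2 d : R, 0 < d &
  forall A, cut (ind A) e -> d <= en J s A.

Let rigid (e : edge) (k : nat) : set (couplings R) :=
  \bigcup_(A : {fset vertex}) [set J : couplings R | cut (ind A) e /\
    exists s s', [/\ gs J s, gs J s' & forall n : nat, en J s A <= k.+1%:R^-1]].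

Let measurable_rigid e k : measurable (rigid e k).
Proof.
apply: measurable_bigcup_count => A.
apply: measurableI; first exact: measurable_cst_prop.
apply: measurable_exists_gs2 => [_|_ s s']; last exact: measurable_en_le.
have [L AL] := sub_box A; exists L.+1 => J s s' u u' su _.
by rewrite (eq_en_box J AL su).
Qed.

(** In [rigid] the ground state may depend on [k]; when there are finitely many, a single one is
    inflexible. *)
Let rigidE e : \bigcap_k rigid e k `&` @finite_gs R =
  [set J : couplings R | finite_gs J /\ exists2 s, gs J s & ~ flexible J e s].
Proof.
apply/seteqP; split=> J /=.
  move=> [JB fJ]; split => //; apply: contrapT => nex.
  have [||k Hk] := @finite_set_bound _ (gs J)
    (fun s k => forall A, cut (ind A) e -> k.+1%:R^-1 < en J s A) _ fJ.
  - move=> s m n mn Hm A Ae; apply: le_lt_trans (Hm A Ae).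
    by rewrite lef_pV2 ?posrE ?ltr0n // ler_nat ltnS.
  - move=> s Js; have [d d0 dP] : flexible J e s.
      by apply: contrapT => ns; apply: nex; exists s.
    have [k kd] : exists k : nat, k.+1%:R^-1 < d.
      exists (Num.truncn d^-1); rewrite invf_plt ?posrE ?ltr0n //.
      exact: truncnS_gt.
    by exists k => A /dP; exact: lt_le_trans.
  have [A _ [Ae [s [_ [Js _ /(_ 0%N)]]]]] := JB k I.
  by rewrite leNgt Hk.
move=> [fJ [s Js ns]]; split => // k _; apply: contrapT => nr; apply: ns.
exists k.+1%:R^-1; first by rewrite invr_gt0 ltr0n.
move=> A Ae; rewrite leNgt; apply/negP => sA; apply: nr.
by exists A => //; split=> //; exists s, s; split => // _; exact: ltW.
Qed.

(* Hence a configuration is inflexible at [e] for at most one value of [J e]. *)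
Lemma gs_strengthen (J : couplings R) e (t t' : R) s :
  (cut s e = false -> t < t') -> (cut s e -> t' < t) ->
  gs (upd J e t) s ->
  gs (upd J e t') s /\ flexible (upd J e t') e s.
Proof.
move=> h1 h2 Jts.
have [d d0 dE] : exists2 d : R, 0 < d & forall A,
    en (upd J e t') s A = en (upd J e t) s A + (cut (ind A) e)%:R * d.
  exists ((t' - t) * (-1) ^+ cut s e).
    move: h1 h2; case: (cut s e) => [_ /(_ isT)|/(_ erefl) h _];
      rewrite ?expr0 ?expr1; lra.
  move=> A; rewrite !en_upd; move: ((-1) ^+ _) (en J s A) => c E.
  by case: (cut (ind A) e) => /=; rewrite ?mul0r ?mul1r ?addr0 //; lra.
split=> [A|]; first by rewrite dE addr_ge0 ?mulr_ge0 ?ler0n // ltW.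
by exists d => // A Ae; rewrite dE Ae mul1r lerDr.
Qed.

(** Fix all couplings but that of [e]. A state inflexible at some value remains a ground state when
    the coupling moves in its favour, so it appears at one of countably many values where ground
    states are finite in number. There are thus countably many such states, each inflexible for at
    most one value, and [mu] has no atoms. *)
Lemma flexible_ae : nu.-negligible (~` [set J : couplings R |
  forall s, gs J s -> forall e, flexible J e s]).
Proof.
apply: (@negligibleS _ _ _ _ (~` @finite_gs R `|`
    \bigcup_(e : edge) (\bigcap_k rigid e k `&` @finite_gs R))).
  move=> J /existsNP[s /not_implyP[Js /existsNP[e nf]]].
  have [fJ|] := pselect (finite_gs J); last by left.
  by right; exists e => //; rewrite rigidE; split => //; exists s.
apply: negligibleU => //; apply: negligible_bigcup_count => e.
have mB : measurable (\bigcap_k rigid e k `&` @finite_gs R).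
  apply: measurableI; last exact: measurable_finite_gs.
  by apply: measurable_bigcap_count => k; exact: measurable_rigid.
apply/(negligibleP _ mB); apply: (resample_null (e := e)) => //.
apply: negligibleS (resample_negligible nu_product e fin0) => J; apply: contra_not.
move=> bad0.
have good a b : a < b -> exists2 t, a < t < b & finite_gs (upd J e t).
  move=> ab; have [t tab nt] := negligible_dense mu_support bad0 ab.
  by exists t => //; apply: contrapT.
have good_up n : {t | n%:R < t & finite_gs (upd J e t)}.
  apply: cid2; have [|t /andP[nt _] ft] := good n%:R (n%:R + 1).
    by rewrite ltrDl.
  by exists t.
have good_dn n : {t | t < - n%:R & finite_gs (upd J e t)}.
  apply: cid2; have [|t /andP[_ tn] ft] := good (- n%:R - 1) (- n%:R).
    by rewrite ltrBlDr ltrDl.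
  by exists t.
pose up n := s2val (good_up n); pose dn n := s2val (good_dn n).
pose at_ s (t : R) := gs (upd J e t) s /\ ~ flexible (upd J e t) e s.
have uniq s t t' : at_ s t -> at_ s t' -> t = t'.
  move=> [h1 h2] [h1' h2']; have [tt'|t't|//] := ltgtP t t'.
    case: (boolP (cut s e)) => se.
      by case: h2; apply: (gs_strengthen _ _ h1').2; rewrite ?se // => /eqP.
    case: h2'; apply: (gs_strengthen _ _ h1).2 => //.
    by rewrite (negbTE se).
  case: (boolP (cut s e)) => se.
    by case: h2'; apply: (gs_strengthen _ _ h1).2; rewrite ?se // => /eqP.
  case: h2; apply: (gs_strengthen _ _ h1').2 => //.
  by rewrite (negbTE se).
(* Each ground state at [t0] contributes its exceptional value, or the default 0 if it has none, so
   the set is finite. *)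
pose D (t0 : R) : set (measurableTypeR R) :=
  (fun s => xget 0 (at_ s)) @` gs (upd J e t0).
apply: (@negligibleS _ _ _ _ (\bigcup_n (D (up n) `|` D (dn n)))); last first.
  apply: negligible_bigcup => n; apply: negligibleU; apply: finite_negligible;
    apply: finite_image; [exact: (s2valP' (good_up n))|exact: (s2valP' (good_dn n))].
move=> t; rewrite rigidE => -[_ [s Js ns]].
have st : at_ s t by [].
have tE : xget 0 (at_ s) = t by exact: uniq (xgetI 0 st) st.
have tn : `|t| < (Num.truncn `|t|).+1%:R by exact: truncnS_gt.
exists (Num.truncn `|t|).+1 => //.
have upt := s2valP (good_up (Num.truncn `|t|).+1).
have dnt := s2valP (good_dn (Num.truncn `|t|).+1).
case: (boolP (cut s e)) => se.
  right; exists s => //; apply: (gs_strengthen _ _ Js).1; first by rewrite se.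
  by move=> _; apply: lt_trans dnt _; move: tn; rewrite ltr_norml => /andP[].
left; exists s => //; apply: (gs_strengthen _ _ Js).1; last by rewrite (negbTE se).
by move=> _; apply: lt_trans upt; exact: le_lt_trans (ler_norm t) tn.
Qed.

(** The first four properties hold on [P]; its subset from [resample_closure] also has
    [generic_dense]. *)
Lemma generic_ae : exists2 Omega : set (couplings R),
  nu.-negligible (~` Omega) & generic Omega.
Proof.
pose P : set (couplings R) := @finite_gs R `&`
  [set J : couplings R | forall s s', gs J s -> gs J s' -> forall x : int,
    s (x, 0%N) != s' (x, 0%N) -> exists2 y, x < y & s (y, 0%N) != s' (y, 0%N)] `&`
  [set J : couplings R | forall s A, A != fset0 -> en J s A != 0] `&`
  [set J : couplings R | forall s, gs J s -> forall e, flexible J e s].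
have P0 : nu.-negligible (~` P).
  rewrite !setCI; apply: negligibleU; last exact: flexible_ae.
  apply: negligibleU; last exact: en_neq0_ae.
  by apply: negligibleU => //; exact: nomax_ae.
have [W [W0 WP Wc]] := resample_closure nu_product P0.
exists W => //; split.
- by move=> J /WP[[[]]].
- by move=> J /WP[[[]]].
- by move=> J /WP[[]].
- by move=> J /WP[].
- move=> J WJ e a b ab.
  have [t tab nO] := negligible_dense mu_support (Wc J WJ e) ab.
  by exists t => //; exact: contrapT.
Qed.

End AlmostSure.

Theorem theorem1p1 (R : realType)
  (mu : probability (measurableTypeR R) R)
  (nu : probability (couplings R) R)
  (mu_atomless : atomless mu)
  (mu_support : law_support mu = [set: R])
  (nu_product : product_law mu nu) :
  {ae nu, forall J : couplings R, ground_states J #= `I_2} \/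
  {ae nu, forall J : couplings R, infinite_set (ground_states J)}.
Proof.
have mfin := @measurable_finite_gs R.
have [fin0|fin1] := shift_invariant_01 nu_product mfin (@finite_gs_shift R).
  right; apply: (@negligibleS _ _ _ _ (@finite_gs R)); last exact/negligibleP.
  move=> J /contrapT; rewrite ground_statesE => fJ.
  apply: (sub_finite_set _ (finite_preimage _ fJ)).
    by move=> s Js; exists s.
  by move=> s s' _ _; exact: spin_inj.
left.
have fin0 : nu.-negligible (~` @finite_gs R).
  apply/negligibleP; first exact: measurableC.
  by apply: etrans (probability_setC nu mfin) _; rewrite fin1 subee.
have [W W0 WP] := generic_ae nu_product mu_atomless mu_support fin0.
by apply: negligibleS W0 => J; apply: contra_not => /(ground_states_card2 WP).
Qed.
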